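(* The process $N(t)$ possesses a steady-state distribution: for every $n\in S$ the limit $q_n=\lim_{t\to+\infty}p_{j,n}(t)$ exists, is the same for all $j\in S$, and is given by $$q_n=\xi\,\widehat\pi_{r,n}(\xi),\qquad n\in S,$$ with $\sum_{n=r}^{+\infty}q_n=1$.
   Context: Let $r$ be a nonnegative integer, $S=\{r,r+1,r+2,\ldots\}$, and let $\alpha_n>0$ ($n\ge r$), $\beta_n\ge 0$ ($n\ge r+1$), $\xi>0$ be constants. $\{N(t);t\ge 0\}$ is the continuous-time Markov chain on $S$ (birth-death process with catastrophes) with transitions: $n\to n+1$ with rate $\alpha_n$ for $n\ge r$; $n\to n-1$ with rate $\beta_n$ for $n\ge r+2$; $r+1\to r$ with rate $\beta_{r+1}+\xi$; $n\to r$ with rate $\xi$ for $n\ge r+2$. Its transition probabilities are $p_{j,n}(t)=\Pr\{N(t)=n\mid N(0)=j\}$. $\{\widehat N(t);t\ge 0\}$ is the birth-death process on $S$ with the same birth rates $\alpha_n$ and death rates $\beta_n$ but without catastrophes (i.e. its only transitions are $n\to n+1$ with rate $\alpha_n$ for $n\ge r$ and $n\to n-1$ with rate $\beta_n$ for $n\ge r+1$). Its transition probabilities are $\widehat p_{j,n}(t)=\Pr\{\widehat N(t)=n\mid\widehat N(0)=j\}$, and it is assumed non-explosive: $\sum_{n\ge r}\widehat p_{j,n}(t)=1$ for all $j\in S$, $t\ge0$. Put $\widehat\pi_{j,n}(\lambda)=\int_0^\infty e^{-\lambda t}\widehat p_{j,n}(t)\,dt$ for $\lambda>0$. *)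

(* Defs.v *)
From HB Require Import structures.
From mathcomp Require Import all_boot all_order all_algebra.
From mathcomp Require Import all_classical all_reals all_analysis.
Set Implicit Arguments.
Unset Strict Implicit.
Unset Printing Implicit Defensive.
Import Order.TTheory GRing.Theory Num.Theory.
Import numFieldNormedType.Exports.
Local Open Scope classical_set_scope.
Local Open Scope ring_scope.

(* A rate function q gives the rate q i n of the transition i -> n for i != n;
   its diagonal is never used. *)

Definition exit_rate (R : realType) (q : nat -> nat -> R) (i : nat) : R :=
  limn (fun m => \sum_(0 <= n < m | n != i) q i n).

Definition jump_prob (R : realType) (q : nat -> nat -> R) (i n : nat) : R :=
  if n == i then 0 else q i n / exit_rate q i.

Definition jump_time (R : realType) (Omega : Type) (T : nat -> Omega -> R)
    (k : nat) (w : Omega) : R :=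
  \sum_(m < k) T m w.

(* X is a continuous-time Markov chain on the states S with rates q, where
   P j is its law given X 0 = j.  The sample paths are described by the
   successive states Y 0, Y 1, ... and the holding times T 0, T 1, ...: given
   Y, the T m are independent and exponential with parameter
   exit_rate q (Y m), and Y is a discrete-time chain with transition
   probabilities jump_prob q.  X t = None when the jump times accumulate
   before or at time t (explosion).
   This is meant for rates with 0 < exit_rate q i for all i in S (there is no
   absorbing state, so all the holding times are finite). *)
Definition is_ctmc (R : realType) (d : measure_display)
    (Omega : measurableType d) (S : set nat) (q : nat -> nat -> R)
    (P : nat -> probability Omega R) (X : R -> Omega -> option nat) : Prop :=
  exists (Y : nat -> Omega -> nat) (T : nat -> Omega -> R),
  [/\ forall k, measurable_fun setT (Y k) /\ measurable_fun setT (T k),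
      forall k w, 0 < T k w,
      forall j, S j -> forall (k : nat) (y : nat -> nat) (t : nat -> R),
        (forall m, 0 <= t m) ->
        P j [set w | forall m, (m <= k)%N -> Y m w = y m /\ t m < T m w] =
        ((y 0%N == j)%:R * \prod_(m < k) jump_prob q (y m) (y m.+1) *
         \prod_(m < k.+1) expR (- (exit_rate q (y m) * t m)))%:E &
      forall t, 0 <= t -> forall w n,
        X t w = Some n <->
        exists k, Y k w = n /\ jump_time T k w <= t < jump_time T k.+1 w].

Definition trans_prob (R : realType) (d : measure_display)
    (Omega : measurableType d) (P : nat -> probability Omega R)
    (X : R -> Omega -> option nat) (j n : nat) (t : R) : R :=
  fine (P j [set w | X t w = Some n]).

Definition laplace (R : realType) (f : R -> R) (s : R) : R :=
  \int[lebesgue_measure]_(t in `[0, +oo[) (expR (- (s * t)) * f t).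

Definition bd_rate (R : realType) (r : nat) (alpha beta : nat -> R)
    (i n : nat) : R :=
  if n == i.+1 then alpha i
  else if (r < i)%N && (n.+1 == i) then beta i
  else 0.

Definition bd_catastrophe_rate (R : realType) (r : nat)
    (alpha beta : nat -> R) (xi : R) (i n : nat) : R :=
  if n == i.+1 then alpha i
  else if (i == r.+1) && (n == r) then beta i + xi
  else if (r.+2 <= i)%N && (n.+1 == i) then beta i
  else if (r.+2 <= i)%N && (n == r) then xi
  else 0.

(* Main.v *)
Require Import Defs.
From HB Require Import structures.
From mathcomp Require Import all_boot all_order all_algebra.
From mathcomp Require Import all_classical all_reals all_analysis.
From mathcomp Require Import measurable_realfun zify ring lra.
Set Implicit Arguments.
Unset Strict Implicit.
Unset Printing Implicit Defensive.
Import Order.TTheory GRing.Theory Num.Theory.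
Import numFieldNormedType.Exports.
Local Open Scope classical_set_scope.
Local Open Scope ring_scope.

(** Write [ph] for the transition probabilities without catastrophes, [p] for
    those with catastrophes, and count a catastrophe occurring in state [r] as a
    jump from [r] to itself.  The function
      [V j t = expR (xi t) p_{j,n}(t) - xi \int_0^t expR (xi s) p_{r,n}(s) ds]
    solves the backward equation of the catastrophe-free process, with initial
    value [j == n], and is bounded on bounded time intervals.  Non-explosion
    makes such a solution unique, so [V j t = ph_{j,n}(t)].  For [j = r] this is
    a linear equation for the integral, and solving it gives
      [p_{j,n}(t) = expR (- xi t) ph_{j,n}(t)
                    + xi \int_0^t expR (- xi s) ph_{r,n}(s) ds],
    from which the limit is read off; non-explosion and dominated convergence
    then give total mass 1.
    The backward equations come from conditioning the sample path on its first
    jump: [bwd K j n t] is the probability to be in [n] at time [t] after fewer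
    than [K] jumps. *)

(** * Derivative rules and differential inequalities *)

Section derivatives.
Context {R : realType}.
Implicit Types (f g : R -> R) (t : R).

Lemma is_derive_eqP f t a b : a = b -> is_derive t 1 f a -> is_derive t 1 f b.
Proof. by move=> ->. Qed.

Lemma is_derive_addf f g t a b : is_derive t 1 f a -> is_derive t 1 g b ->
  is_derive t 1 (fun x => f x + g x) (a + b).
Proof. by move=> fa gb; exact: is_deriveD. Qed.

Lemma is_derive_subf f g t a b : is_derive t 1 f a -> is_derive t 1 g b ->
  is_derive t 1 (fun x => f x - g x) (a - b).
Proof. by move=> fa gb; exact: is_deriveB. Qed.

Lemma is_derive_mulf f g t a b : is_derive t 1 f a -> is_derive t 1 g b ->
  is_derive t 1 (fun x => f x * g x) (a * g t + f t * b).
Proof.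
move=> fa gb; apply: is_derive_eqP (is_deriveM fa gb).
by rewrite /GRing.scale/= addrC [g t * a]mulrC.
Qed.

Lemma is_derive_cstf (c : R) t : is_derive t 1 (fun=> c) 0.
Proof. exact: is_derive_cst. Qed.

Lemma is_derive_scalef (c : R) f t a : is_derive t 1 f a ->
  is_derive t 1 (fun x => c * f x) (c * a).
Proof.
move=> fa; apply: is_derive_eqP (is_derive_mulf (is_derive_cstf c t) fa).
by rewrite mul0r add0r.
Qed.

Lemma is_derive_compf f g t a b : is_derive t 1 g b -> is_derive (g t) 1 f a ->
  is_derive t 1 (fun x => f (g x)) (a * b).
Proof. by move=> gb fa; exact: is_derive1_comp. Qed.

Lemma is_derive_expRM (c t : R) :
  is_derive t 1 (fun x => expR (c * x)) (c * expR (c * t)).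
Proof.
have dc : is_derive t 1 (fun x => c * x) c.
  by apply: is_derive_eqP (is_derive_scalef c (is_derive_id t 1)); rewrite mulr1.
by rewrite mulrC; exact: is_derive_compf dc (is_derive_expR _).
Qed.

Lemma is_derive_sumf (I : Type) (l : seq I) (F : I -> R -> R) t (a : I -> R) :
  (forall i, is_derive t 1 (F i) (a i)) ->
  is_derive t 1 (fun x => \sum_(i <- l) F i x) (\sum_(i <- l) a i).
Proof.
move=> Fa; elim: l => [|i l IH].
  rewrite big_nil (_ : (fun _ => _) = fun=> 0); first exact: is_derive_cstf.
  by apply/funext => x; rewrite big_nil.
rewrite big_cons (_ : (fun _ => _) = fun x => F i x + \sum_(k <- l) F k x).
  exact: is_derive_addf.
by apply/funext => x; rewrite big_cons.
Qed.

Lemma is_derive_continuous f t a : is_derive t 1 f a -> {for t, continuous f}.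
Proof.
by move=> [df _]; apply: differentiable_continuous; exact/derivable1_diffP.
Qed.

Lemma is_derive_ndecr f (df : R -> R) a b : a <= b ->
  (forall t, a <= t <= b -> is_derive t 1 f (df t)) ->
  (forall t, a <= t <= b -> 0 <= df t) -> f a <= f b.
Proof.
move=> ab dfE df0; rewrite -subr_ge0.
have [| |c /itvP cab ->] := @MVT_segment R f df a b ab.
- by move=> x /itvP xab; apply: dfE; rewrite !xab.
- apply: derivable_within_continuous => x /itvP xab.
  by have [] := dfE x; rewrite ?xab.
by rewrite mulr_ge0 ?subr_ge0// df0// !cab.
Qed.

(** Integrating factor: [expR (a * t) * f t] has derivative [expR (a * t) * (a * f t + df t) >= 0],
    so it stays above its initial value. *)
Lemma linear_ode_ge0 f (df : R -> R) (a T : R) :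
  (forall t, 0 <= t <= T -> is_derive t 1 f (df t)) ->
  (forall t, 0 <= t <= T -> 0 <= a * f t + df t) ->
  0 <= f 0 -> forall t, 0 <= t <= T -> 0 <= f t.
Proof.
move=> dfE df0 f0 t /andP[t0 tT].
rewrite -(pmulr_rge0 _ (expR_gt0 (a * t))).
apply: (@le_trans _ _ (expR (a * 0) * f 0)).
  by rewrite mulr_ge0// expR_ge0.
apply: (@is_derive_ndecr (fun s => expR (a * s) * f s)
    (fun s => expR (a * s) * (a * f s + df s))) => //.
- move=> s /andP[s0 st].
  apply: is_derive_eqP (is_derive_mulf (is_derive_expRM a s) (dfE s _)).
    by rewrite mulrDr mulrA [expR _ * a]mulrC.
  by rewrite s0 (le_trans st).
- move=> s /andP[s0 st]; rewrite mulr_ge0 ?expR_ge0// df0//.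
  by rewrite s0 (le_trans st).
Qed.

Lemma is_derive_lipschitz f (df : R -> R) (L a b : R) : a <= b ->
  (forall t, a <= t <= b -> is_derive t 1 f (df t)) ->
  (forall t, a <= t <= b -> `|df t| <= L) -> `|f b - f a| <= L * (b - a).
Proof.
move=> ab dfE dfL.
(* With [e] equal to 1 and to -1, monotonicity of [L * x - e * f x] gives the two sides of the
   bound. *)
have LB (e : R) : `|e| <= 1 -> e * f b - L * b <= e * f a - L * a.
  move=> e1; suff : L * a - e * f a <= L * b - e * f b by lra.
  apply: (@is_derive_ndecr (fun x => L * x - e * f x)
    (fun t => L * 1 - e * df t)) => //.
    move=> t tab; apply: is_derive_subf; apply: is_derive_scalef.
    exact: dfE.
  move=> t tab; rewrite subr_ge0 mulr1 (le_trans (ler_norm _))// normrM.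
  rewrite (le_trans _ (dfL _ tab))// -[leRHS]mul1r.
  by rewrite ler_wpM2r.
rewrite ler_norml; apply/andP; split.
  have := LB (-1); rewrite normrN1 lexx => /(_ isT); lra.
have := LB 1; rewrite normr1 lexx => /(_ isT); lra.
Qed.

Lemma continuous_max0 g : (forall s, 0 <= s -> {for s, continuous g}) ->
  continuous (fun s : R => g (Num.max 0 s)).
Proof.
move=> cg s; apply: (@continuous_comp _ _ _ (fun s : R => Num.max 0 s) g).
  by apply: continuous_max; [exact: cvg_cst|exact: cvg_id].
by apply: cg; rewrite le_max lexx.
Qed.

End derivatives.

(** * Finite sums and order bounds under limits *)

Lemma cvgr_sum (R : realType) (T I : Type) (F : set_system T) (FF : Filter F)
    (s : seq I) (f : I -> T -> R) (a : I -> R) :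
  (forall i, f i x @[x --> F] --> a i) ->
  \sum_(i <- s) f i x @[x --> F] --> \sum_(i <- s) a i.
Proof. by move=> fa; apply: cvg_big => //; exact: add_continuous. Qed.

Lemma cvgr_le_cst (R : realType) (u : nat -> R) (l x : R) :
  u n @[n --> \oo] --> l -> (forall n, u n <= x) -> l <= x.
Proof.
move=> ul ux; rewrite -(cvg_lim _ ul)//.
by apply: limr_le; [exact: cvgP ul|exact: nearW].
Qed.

Lemma cvgr_ge_cst (R : realType) (u : nat -> R) (l x : R) :
  u n @[n --> \oo] --> l -> (forall n, x <= u n) -> x <= l.
Proof.
move=> ul ux; rewrite -(cvg_lim _ ul)//.
by apply: limr_ge; [exact: cvgP ul|exact: nearW].
Qed.

(** * Primitives, variation of constants and dominated convergence *)

Section primitive.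
Context {R : realType}.
Notation mu := (@lebesgue_measure R).
Implicit Types (f g : R -> R) (t : R).

(* Starting at -1 rather than 0 makes [prim g] two-sided differentiable at 0;
   only the values of [g] on the nonnegative reals matter. *)
Definition prim g t : R :=
  \int[mu]_(s in `[-1, t]) g (Num.max 0 s) -
  \int[mu]_(s in `[-1, 0]) g (Num.max 0 s).

Lemma prim0 g : prim g 0 = 0.
Proof. exact: subrr. Qed.

Lemma integrable_max0 g a b : continuous (fun s : R => g (Num.max 0 s)) ->
  mu.-integrable `[a, b] (EFin \o (fun s => g (Num.max 0 s))).
Proof.
move=> cg; apply: continuous_compact_integrable; first exact: segment_compact.
exact: continuous_subspaceT.
Qed.

Lemma is_derive_prim_max0 g t : continuous (fun s : R => g (Num.max 0 s)) ->
  0 <= t -> is_derive t 1 (prim g) (g t).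
Proof.
move=> cg t0.
have tt1 : t < t + 1 by rewrite ltrDl.
have t1 : -1 < t by rewrite (lt_le_trans _ t0)// ltrN10.
have [|dF F'] := continuous_FTC1_closed tt1 (integrable_max0 (-1) (t + 1) cg) t1.
  exact: cg.
apply: is_derive_eqP (is_derive_subf (derivableP dF) (is_derive_cstf _ _)).
rewrite subr0 -derive1E F'.
by congr g; apply/max_idPr.
Qed.

Lemma is_derive_prim g t : (forall s, 0 <= s -> {for s, continuous g}) ->
  0 <= t -> is_derive t 1 (prim g) (g t).
Proof. by move=> /continuous_max0; exact: is_derive_prim_max0. Qed.

(** Variation of constants for [y' = - a * y + h] with [y 0 = c]. Clamping the argument of [h] asks
    for its continuity on the nonnegative reals only. *)
Lemma is_derive_linear_ode (a c : R) (h : R -> R) t :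
  continuous (fun s : R => h (Num.max 0 s)) -> 0 <= t ->
  is_derive t 1 (fun t => expR (- a * t) * (c + prim (fun s => expR (a * s) * h s) t))
    (- a * (expR (- a * t) * (c + prim (fun s => expR (a * s) * h s) t)) + h t).
Proof.
move=> ch t0.
have dprim : is_derive t 1 (prim (fun s => expR (a * s) * h s)) (expR (a * t) * h t).
  apply: is_derive_prim_max0 => // s; apply: cvgM; last exact: ch.
  apply: (@continuous_max0 _ (fun s => expR (a * s))) => x _.
  exact: is_derive_continuous (is_derive_expRM a x).
apply: is_derive_eqP (is_derive_mulf (is_derive_expRM (- a) t)
  (is_derive_addf (is_derive_cstf c t) dprim)).
rewrite add0r mulrA; congr (_ + _).
  by rewrite !mulrA.
by rewrite -expRD mulNr addNr expR0 mul1r.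
Qed.

(** Clamping to the nonnegative reals is 1-Lipschitz, so the composite keeps the constant [L]. *)
Lemma continuous_max0_lipschitz g (L : R) : 0 <= L ->
  (forall u v, 0 <= u -> u <= v -> `|g v - g u| <= L * (v - u)) ->
  continuous (fun s : R => g (Num.max 0 s)).
Proof.
move=> L0 gL x; apply/cvgrPdist_le => e e0.
near=> y; set u := Num.max 0 x; set v := Num.max 0 y.
have u0 : 0 <= u by rewrite le_max lexx.
have v0 : 0 <= v by rewrite le_max lexx.
have uv : `|u - v| <= `|x - y|.
  rewrite /u /v; case: (leP 0 x) => x0; case: (leP 0 y) => y0 //.
  - rewrite subr0 ger0_norm//; apply: le_trans (ler_norm _); lra.
  - rewrite sub0r normrN ger0_norm// distrC; apply: le_trans (ler_norm _); lra.
  - by rewrite subrr normr0.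
have gg : `|g u - g v| <= L * `|u - v|.
  have [uv'|vu] := leP u v.
    by rewrite distrC (distrC u) [`|v - u|]ger0_norm ?subr_ge0// gL.
  by rewrite [`|u - v|]ger0_norm ?subr_ge0 ?(ltW vu)// gL// ltW.
rewrite (le_trans gg)// (le_trans (ler_wpM2l L0 uv))//.
(* [L + 1] replaces [L] so that the divisor is positive even when [L] is 0. *)
rewrite (le_trans (_ : _ <= (L + 1) * `|x - y|)) ?ler_wpM2r ?lerDl//.
rewrite mulrC -ler_pdivlMr ?ltr_wpDl//.
near: y; apply: cvgr_dist_le; first exact: cvg_id.
by rewrite divr_gt0// ltr_wpDl.
Unshelve. all: by end_near. Qed.

Lemma Rintegral_cvg (f_ : nat -> R -> R) f (a b M : R) :
  (forall n, continuous (f_ n)) -> continuous f ->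
  (forall x, a <= x <= b -> f_ n x @[n --> \oo] --> f x) ->
  (forall n x, a <= x <= b -> `|f_ n x| <= M) ->
  \int[mu]_(x in `[a, b]) f_ n x @[n --> \oo] --> \int[mu]_(x in `[a, b]) f x.
Proof.
move=> cf_ cf f_f fM.
have int g : continuous g -> mu.-integrable `[a, b] (EFin \o g).
  move=> cg; apply: continuous_compact_integrable; first exact: segment_compact.
  exact: continuous_subspaceT.
have fin : (\int[mu]_(x in `[a, b]) (f x)%:E)%E \is a fin_num.
  by apply: integrable_fin_num => //; exact: int.
apply: fine_cvg; rewrite fineK//.
apply: (@dominated_cvg _ _ R mu `[a, b]%classic (measurable_itv _)
  (fun n x => (f_ n x)%:E) (fun x => (f x)%:E) (fun=> M%:E)) => //.
- by move=> n; exact: measurable_int (int _ (cf_ n)).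
- move=> x /=; rewrite in_itv/= => xab; apply: cvg_EFin; first exact: nearW.
  exact: f_f.
- by apply: (int (fun=> M)) => x; exact: cvg_cst.
Qed.

(** [prim] is a difference of two integrals starting at -1. Dominated convergence applies to each,
    with upper end [t] and 0, because clamped arguments stay in [[0, t]]. *)
Lemma prim_cvg (g_ : nat -> R -> R) g (t M : R) : 0 <= t ->
  (forall n, continuous (fun s : R => g_ n (Num.max 0 s))) ->
  continuous (fun s : R => g (Num.max 0 s)) ->
  (forall s, 0 <= s <= t -> g_ n s @[n --> \oo] --> g s) ->
  (forall n s, 0 <= s <= t -> `|g_ n s| <= M) ->
  prim (g_ n) t @[n --> \oo] --> prim g t.
Proof.
move=> t0 cg_ cg g_g gM.
have max_itv b x : 0 <= b <= t -> -1 <= x <= b -> 0 <= Num.max 0 x <= t.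
  move=> /andP[b0 bt] /andP[_ xb].
  by rewrite le_max lexx/= ge_max t0 (le_trans xb).
have tt : 0 <= t <= t by rewrite t0 lexx.
have tz : (0 : R) <= 0 <= t by rewrite lexx t0.
have aux b : 0 <= b <= t ->
    \int[mu]_(s in `[-1, b]) g_ n (Num.max 0 s) @[n --> \oo] -->
    \int[mu]_(s in `[-1, b]) g (Num.max 0 s).
  move=> bt; apply: (@Rintegral_cvg (fun n s => g_ n (Num.max 0 s))
    (fun s => g (Num.max 0 s)) _ _ M) => // [x|n x] /(max_itv _ _ bt).
    exact: g_g.
  exact: gM.
by apply: cvgB; exact: aux.
Qed.

End primitive.

(** * Riemann sums against an exponential law *)

Section riemann.
Context {R : realType}.
Variables (Q L t : R) (f g : R -> R).
Hypotheses (t_ge0 : 0 <= t) (Q_ge0 : 0 <= Q) (L_ge0 : 0 <= L).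
Hypothesis df : forall s, 0 <= s <= t ->
  is_derive s 1 f (- Q * f s + Q * g s).
Hypothesis g_lip : forall u v, 0 <= u -> u <= v -> v <= t ->
  `|g v - g u| <= L * (v - u).

(** By the equation for [f], [- psi] is a primitive of [Q * expR (- Q * x) * g (t - x)], the
    integrand of the first-jump decomposition. *)
Let psi x := expR (- Q * x) * f (t - x).

Let dpsi x : 0 <= x <= t ->
  is_derive x 1 psi (- Q * expR (- Q * x) * g (t - x)).
Proof.
move=> /andP[x0 xt].
have dft : is_derive (t - x) 1 f (- Q * f (t - x) + Q * g (t - x)).
  by apply: df; rewrite subr_ge0 xt gerBl.
have dtx := is_derive_subf (is_derive_cstf t x) (is_derive_id x (1 : R)).
apply: is_derive_eqP (is_derive_mulf (is_derive_expRM (- Q) x)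
  (is_derive_compf dtx dft)).
by rewrite sub0r mulrN1; ring.
Qed.

(** The decrement of [psi] is the integral of [g (t - x)] against the exponential law on [[a, b]],
    where [g (t - x)] is within [L * (b - a)] of [g (t - a)]. Monotonicity of an auxiliary function
    stands in for the integral. *)
Lemma riemann_step a b : 0 <= a -> a <= b -> b <= t ->
  `|psi a - psi b - (expR (- Q * a) - expR (- Q * b)) * g (t - a)| <=
    L * (b - a) * (expR (- Q * a) - expR (- Q * b)).
Proof.
move=> a0 ab bt.
have LB (e : R) : `|e| <= 1 ->
  e * psi b - expR (- Q * b) * (e * g (t - a) - L * (b - a)) <=
  e * psi a - expR (- Q * a) * (e * g (t - a) - L * (b - a)).
  move=> e1; set K := (e * g (t - a) - L * (b - a)).
  rewrite -[leLHS]opprB -[leRHS]opprB lerN2.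
  apply: (@is_derive_ndecr _ (fun x => expR (- Q * x) * K - e * psi x)
     (fun x => Q * expR (- Q * x) * (e * (g (t - x) - g (t - a)) + L * (b - a))) _ _ ab).
    move=> x /andP[ax xb].
    have dx : is_derive x 1 psi (- Q * expR (- Q * x) * g (t - x)).
      by apply: dpsi; rewrite (le_trans a0 ax) (le_trans xb bt).
    apply: is_derive_eqP (is_derive_subf
      (is_derive_mulf (is_derive_expRM (- Q) x) (is_derive_cstf K x))
      (is_derive_scalef e dx)).
    by rewrite /K mulr0 addr0; ring.
  move=> x /andP[ax xb]; rewrite mulr_ge0 ?mulr_ge0 ?expR_ge0//.
  have : `|e * (g (t - x) - g (t - a))| <= L * (b - a).
    rewrite normrM (le_trans (_ : _ <= 1 * `|g (t - x) - g (t - a)|))//.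
      by rewrite ler_wpM2r.
    rewrite mul1r distrC (le_trans (g_lip _ _ _))//.
    - by rewrite subr_ge0 (le_trans xb).
    - by rewrite lerD2l lerN2.
    - by rewrite gerBl.
    by rewrite ler_wpM2l//; lra.
  by rewrite ler_norml => /andP[+ _]; lra.
rewrite ler_norml; apply/andP; split.
  have := LB 1; rewrite normr1 lexx => /(_ isT); lra.
have := LB (-1); rewrite normrN1 lexx => /(_ isT); lra.
Qed.

(** As [f 0 = 0], [f t] is [psi 0 - psi t], which telescopes over the mesh of width [h]. The step
    errors add up to at most [L * h * (1 - expR (- Q * t))], of order [1 / N]. *)
Lemma riemann_cvg : f 0 = 0 ->
  \sum_(l < N.+1) (expR (- Q * (l%:R * (t / N.+1%:R))) -
     expR (- Q * (l.+1%:R * (t / N.+1%:R)))) * g (t - l%:R * (t / N.+1%:R))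
   @[N --> \oo] --> f t.
Proof.
move=> f0.
have bnd N : `|f t - \sum_(l < N.+1) (expR (- Q * (l%:R * (t / N.+1%:R))) -
     expR (- Q * (l.+1%:R * (t / N.+1%:R)))) * g (t - l%:R * (t / N.+1%:R))| <=
    L * t * N.+1%:R^-1.
  set h := t / N.+1%:R.
  have h0 : 0 <= h by rewrite divr_ge0.
  have Nh : N.+1%:R * h = t by rewrite mulrC divfK// pnatr_eq0.
  have tel (F : R -> R) : \sum_(l < N.+1) (F (l%:R * h) - F (l.+1%:R * h)) = F 0 - F t.
    rewrite -(big_mkord xpredT (fun l => F (l%:R * h) - F (l.+1%:R * h))).
    under eq_bigr do rewrite -opprB.
    rewrite sumrN telescope_sumr// opprB Nh mul0r//.
  have -> : f t = psi 0 - psi t.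
    by rewrite /psi subr0 subrr f0 !mulr0 expR0 mul1r subr0.
  rewrite -tel -sumrB.
  apply: (le_trans (ler_norm_sum _ _ _)).
  apply: (@le_trans _ _ (\sum_(l < N.+1) L * h * (expR (- Q * (l%:R * h)) -
     expR (- Q * (l.+1%:R * h))))).
    apply: ler_sum => l _.
    have -> : L * h = L * (l.+1%:R * h - l%:R * h).
      by rewrite -mulrBl -natrB// subSnn mul1r.
    apply: riemann_step.
    - by rewrite mulr_ge0.
    - by rewrite ler_wpM2r// ler_nat.
    - by rewrite -Nh ler_wpM2r// ler_nat.
  rewrite -mulr_sumr (tel (fun x => expR (- Q * x))) mulr0 expR0.
  have -> : L * t * N.+1%:R^-1 = L * h * 1 by rewrite mulr1 /h mulrA.
  apply: ler_wpM2l.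
    by rewrite mulr_ge0.
  by rewrite gerBl expR_ge0.
have h : L * t * N.+1%:R^-1 @[N --> \oo] --> (0 : R).
  rewrite -(mulr0 (L * t)); apply: cvgM; first exact: cvg_cst.
  exact: cvg_harmonic.
apply/cvgrPdist_le => e e0.
near=> N; apply: (le_trans (bnd N)).
near: N; move/cvgrPdist_le: h => /(_ _ e0); apply: filterS => N.
rewrite sub0r normrN ger0_norm//.
by rewrite mulr_ge0 ?mulr_ge0.
Unshelve. all: by end_near. Qed.

End riemann.

(** * Iterates of the backward equation *)

Section backward.
Context {R : realType}.
Variables (r : nat) (q : nat -> nat -> R).

(* Jumps go up by at most one, so this finite sum is the whole exit rate. *)
Definition out_rate (i : nat) : R := \sum_(n < i.+2) q i n.

(** Conditions shared by the rates with and without catastrophes: only upward jumps are limited to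
    size one, downward jumps may have any size as long as they do not pass below [r]. *)
Definition skip_free := [/\
  forall i n, (r <= i)%N -> 0 <= q i n,
  forall i n, (r <= i)%N -> (i.+1 < n)%N -> q i n = 0,
  forall i, (r <= i)%N -> q i i = 0,
  forall i n, (r <= i)%N -> (n < r)%N -> q i n = 0 &
  forall i, (r <= i)%N -> 0 < out_rate i].

(** First-jump conditioning in variation-of-constants form: [s] is the time left after the first
    jump, and the term [j == n] accounts for the paths without a jump. *)
Fixpoint bwd (K j n : nat) (t : R) : R :=
  if K is K'.+1 then
    expR (- out_rate j * t) * ((j == n)%:R +
      prim (fun s => expR (out_rate j * s) *
        \sum_(i < j.+2) q j i * bwd K' i n s) t)
  else 0.

(** The derivative at one level needs continuity of the level below, which comes from the derivative
    of that level; hence the joint induction. *)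
Lemma bwd_derive_continuous K j n (t : R) : 0 <= t ->
  is_derive t 1 (bwd K.+1 j n)
    (- out_rate j * bwd K.+1 j n t + \sum_(i < j.+2) q j i * bwd K i n t) /\
  {for t, continuous (bwd K j n)}.
Proof.
elim: K j t => [|K IH] j t t0.
  split; last by move=> /=; exact: cvg_cst.
  apply: (@is_derive_linear_ode _ _ _
    (fun s => \sum_(i < j.+2) q j i * bwd 0%N i n s)) => //; move=> s.
  rewrite (_ : (fun s => _) = fun=> 0); first exact: cst_continuous.
  by apply/funext => x; rewrite big1// => i _; rewrite mulr0.
have cA i s : 0 <= s -> {for s, continuous (bwd K.+1 i n)}.
  by move=> s0; have [] := IH i s s0 => /is_derive_continuous.
split; last exact: cA.
apply: is_derive_linear_ode => //.
apply: (@continuous_max0 _ (fun s => \sum_(i < j.+2) q j i * bwd K.+1 i n s)) => s s0.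
apply: cvgr_sum => i; apply: cvgM; first exact: cvg_cst.
exact: cA.
Qed.

Lemma bwd_derive K j n (t : R) : 0 <= t -> is_derive t 1 (bwd K.+1 j n)
  (- out_rate j * bwd K.+1 j n t + \sum_(i < j.+2) q j i * bwd K i n t).
Proof. by move=> /(bwd_derive_continuous K j n)[]. Qed.

Lemma bwd_continuous K j n (t : R) : 0 <= t -> {for t, continuous (bwd K j n)}.
Proof. by move=> /(bwd_derive_continuous K j n)[]. Qed.

Lemma bwd0 K j n : bwd K.+1 j n 0 = (j == n)%:R.
Proof. by rewrite /= prim0 mulr0 expR0 mul1r addr0. Qed.

Hypothesis qP : skip_free.

Lemma ler_sum_rate j (x y : nat -> R) : (r <= j)%N ->
  (forall i, (r <= i)%N -> x i <= y i) ->
  \sum_(i < j.+2) q j i * x i <= \sum_(i < j.+2) q j i * y i.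
Proof.
have [q0 _ _ qlow _] := qP.
move=> rj xy; apply: ler_sum => i _; have [ri|ir] := leqP r i.
  by rewrite ler_wpM2l ?q0// xy.
by rewrite qlow// !mul0r.
Qed.

Lemma sum_rate_itv j (x : nat -> R) : (r <= j)%N ->
  (forall i, (r <= i)%N -> 0 <= x i <= 1) ->
  0 <= \sum_(i < j.+2) q j i * x i <= out_rate j.
Proof.
move=> rj x01; apply/andP; split.
  have := @ler_sum_rate j (fun=> 0) x rj; rewrite big1 => [|i _].
    by apply=> i /x01/andP[].
  by rewrite mulr0.
have -> : out_rate j = \sum_(i < j.+2) q j i * 1.
  by apply: eq_bigr => i _; rewrite mulr1.
by apply: (@ler_sum_rate j x (fun=> 1) rj) => i /x01/andP[].
Qed.

(** Both [bwd] and [1 - bwd] solve linear equations with nonnegative forcing, since the sum over the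
    previous level lies between 0 and [out_rate j]. *)
Lemma bwd_itv K j n (t : R) : (r <= j)%N -> 0 <= t -> 0 <= bwd K j n t <= 1.
Proof.
elim: K j t => [|K IH] j t rj t0; first by rewrite /= lexx ler01.
have tt : 0 <= t <= t by rewrite t0 lexx.
have sum_itv s : 0 <= s <= t ->
    0 <= \sum_(i < j.+2) q j i * bwd K i n s <= out_rate j.
  move=> /andP[s0 _]; apply: (@sum_rate_itv j (fun i => bwd K i n s)) => // i ri.
  exact: IH.
apply/andP; split.
  apply: (linear_ode_ge0 (a := out_rate j) _ _ _ tt).
  - by move=> s /andP[s0 _]; exact: bwd_derive.
  - by move=> s /sum_itv/andP[+ _]; rewrite addrA mulNr subrr add0r.
  - by rewrite bwd0 ler0n.
rewrite -subr_ge0.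
apply: (@linear_ode_ge0 _ (fun t => 1 - bwd K.+1 j n t) (fun s => 0 -
  (- out_rate j * bwd K.+1 j n s + \sum_(i < j.+2) q j i * bwd K i n s))
  (out_rate j) t _ _ _ t tt).
- move=> s /andP[s0 _].
  exact: is_derive_subf (is_derive_cstf _ _) (bwd_derive _ _ _ s0).
- move=> s /sum_itv/andP[_].
  move: (bwd K.+1 j n s) (\sum_(i < _) _) => x y; lra.
- by rewrite bwd0; case: eqP => _; rewrite ?subrr ?subr0.
Qed.

(** The derivative is a difference of two numbers in [[0, out_rate j]]. The constant does not depend
    on [K], so the bound survives the limit in [K]. *)
Lemma bwd_lipschitz K j n (u v : R) : (r <= j)%N -> 0 <= u -> u <= v ->
  `|bwd K j n v - bwd K j n u| <= out_rate j * (v - u).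
Proof.
have [_ _ _ _ Q0] := qP; move=> rj u0 uv; case: K => [|K].
  by rewrite /= subrr normr0 mulr_ge0 ?subr_ge0// ltW// Q0.
apply: is_derive_lipschitz uv _ _ => t /andP[ut _];
    have t0 := le_trans u0 ut; first exact: bwd_derive.
have /andP[b0 b1] := bwd_itv K.+1 n rj t0.
have /andP[Qb0 Qb1] : 0 <= out_rate j * bwd K.+1 j n t <= out_rate j.
  by rewrite mulr_ge0 ?(ltW (Q0 _ rj))//= -[leRHS]mulr1 ler_wpM2l// ltW// Q0.
have /andP[S0 S1] : 0 <= \sum_(i < j.+2) q j i * bwd K i n t <= out_rate j.
  by apply: (@sum_rate_itv j (fun i => bwd K i n t)) => // i ri; exact: bwd_itv.
rewrite ler_norml mulNr; move: Qb0 Qb1 S0 S1.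
by move: (_ * bwd _ _ _ _) (\sum_(i < _) _) => x y; lra.
Qed.

Lemma exit_rateE i : (r <= i)%N -> exit_rate q i = out_rate i.
Proof.
have [_ qup qd _ _] := qP.
move=> ri; apply: cvg_lim => //; apply: cvg_near_cst.
exists i.+2 => // m /= im; rewrite (big_cat_nat_idem _ _ im)//= ?addr0//.
rewrite [X in _ + X]big_nat_cond [X in _ + X]big1 ?addr0; last first.
  by move=> n /andP[/andP[ni _] _]; rewrite qup.
rewrite big_mkcond/= big_mkord; apply: eq_bigr => n _.
by case: eqP => //= ->; rewrite qd.
Qed.

Lemma jump_probE j i : (r <= j)%N -> jump_prob q j i = q j i / out_rate j.
Proof.
have [_ _ qd _ _] := qP; move=> rj; rewrite /jump_prob exit_rateE//.
by case: eqP => // ->; rewrite qd// mul0r.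
Qed.

End backward.

(** * Convergence of probabilities of events *)

Section measure_cvg.
Context {R : realType} d (T : measurableType d) (P : probability T R).

(** Dominated convergence for the indicators, with dominating function 1. *)
Lemma cvg_measure_eventually (F : nat -> set T) (E : set T) :
  (forall N, measurable (F N)) -> measurable E ->
  (forall w, \forall N \near \oo, F N w <-> E w) ->
  P (F N) @[N --> \oo] --> P E.
Proof.
move=> mF mE FE.
have m1 A : measurable A -> measurable_fun setT (EFin \o (\1_A : T -> R)).
  by move=> mA; exact/measurable_EFinP/measurable_indic.
have := @dominated_cvg _ T R P setT measurableT
  (fun N w => (\1_(F N) w)%:E) (fun w => (\1_E w)%:E) (cst 1%:E).
under eq_fun do rewrite integral_indic// setIT.
rewrite integral_indic// setIT; apply.
- by move=> n; exact: m1.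
- move=> w _; apply: cvg_near_cst.
  move: (FE w); apply: filterS => N h.
  by congr EFin; rewrite !indicE; congr (_%:R); congr nat_of_bool;
    apply/idP/idP; rewrite !inE => /h.
- by [].
- exact: finite_measure_integrable_cst.
- by move=> n w _ /=; rewrite lee_fin indicE normr_nat; case: (_ \in _).
Qed.

End measure_cvg.

(** * Path laws on cylinders and the Markov property at the first jump *)

Section path_law.
Context {R : realType} d (Omega : measurableType d) (P : probability Omega R).
Variables (r : nat) (q : nat -> nat -> R).
Implicit Types (D : set Omega) (Y : nat -> Omega -> nat)
  (T : nat -> Omega -> R) (s : nat -> R) (y : nat -> nat).

Definition cylinder Y T k y s : set Omega :=
  [set w | forall m, (m <= k)%N -> Y m w = y m /\ s m < T m w].

Definition hit Y T K n (t : R) : set Omega :=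
  [set w | exists k, [/\ (k < K)%N, Y k w = n &
                      jump_time T k w <= t < jump_time T k.+1 w]].

Definition cylinder_law (j k : nat) y s : R :=
  (y 0%N == j)%:R * \prod_(m < k) jump_prob q (y m) (y m.+1) *
  \prod_(m < k.+1) expR (- (exit_rate q (y m) * s m)).

(* Under P restricted to D, the pair (Y, T) has c times the law of the chain
   started at j; D records the part of the path already explored. *)
Definition path_law D Y T (j : nat) (c : R) : Prop :=
  [/\ measurable D,
      forall k, measurable_fun setT (Y k) /\ measurable_fun setT (T k),
      forall k w, 0 < T k w,
      P D = c%:E &
      forall k y s, (forall m, 0 <= s m) ->
        P (D `&` cylinder Y T k y s) = (c * cylinder_law j k y s)%:E].

Definition shift (A : Type) (Z : nat -> A) : nat -> A := fun k => Z k.+1.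

Lemma jump_timeS T k w :
  jump_time T k.+1 w = T 0%N w + jump_time (shift T) k w.
Proof. by rewrite /jump_time big_ord_recl. Qed.

Lemma jump_time_ge0 T k w : (forall k w, 0 < T k w) -> 0 <= jump_time T k w.
Proof. by move=> T0; apply: sumr_ge0 => m _; exact: ltW. Qed.

Lemma measurable_preimage_nat (f : Omega -> nat) n :
  measurable_fun setT f -> measurable [set w | f w = n].
Proof. by move=> mf; rewrite -[X in measurable X]setTI; exact: (mf _ [set n]). Qed.

Lemma measurable_preimage_gt (f : Omega -> R) x :
  measurable_fun setT f -> measurable [set w | x < f w].
Proof.
move=> mf; rewrite -[X in measurable X]setTI.
have -> : [set w | x < f w] = f @^-1` `]x, +oo[.
  by apply/seteqP; split => w /=; rewrite in_itv/= andbT.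
exact: mf.
Qed.

Lemma measurable_preimage_le (f : Omega -> R) x :
  measurable_fun setT f -> measurable [set w | f w <= x].
Proof.
move=> mf; rewrite -[X in measurable X]setTI.
have -> : [set w | f w <= x] = f @^-1` `]-oo, x].
  by apply/seteqP; split => w /=; rewrite in_itv/=.
exact: mf.
Qed.

Section measurability.
Variables (Y : nat -> Omega -> nat) (T : nat -> Omega -> R).
Hypothesis mYT : forall k, measurable_fun setT (Y k) /\ measurable_fun setT (T k).

Lemma measurable_jump_time k : measurable_fun setT (jump_time T k).
Proof.
apply: (@measurable_sum _ Omega R setT _ (index_enum 'I_k) (fun m w => T m w)) => m.
by have [] := mYT m.
Qed.

Lemma measurable_cylinder k y s : measurable (cylinder Y T k y s).
Proof.
have -> : cylinder Y T k y s = \bigcap_(m in [set m | (m <= k)%N])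
    ([set w | Y m w = y m] `&` [set w | s m < T m w]) by [].
apply: bigcap_measurable; first by exists 0%N.
move=> m _; have [mY mT] := mYT m.
by apply: measurableI; [exact: measurable_preimage_nat|exact: measurable_preimage_gt].
Qed.

Lemma measurable_hit K n t : measurable (hit Y T K n t).
Proof.
have -> : hit Y T K n t = \bigcup_(k in [set k | (k < K)%N])
    ([set w | Y k w = n] `&`
     ([set w | jump_time T k w <= t] `&` [set w | t < jump_time T k.+1 w])).
  apply/seteqP; split => w /= [k].
    by move=> [kK Yk /andP[J1 J2]]; exists k.
  by move=> kK [Yk [J1 J2]]; exists k; split => //; apply/andP.
apply: bigcup_measurable => k _; have [mY mT] := mYT k.
apply: measurableI; first exact: measurable_preimage_nat.
apply: measurableI.
  exact/measurable_preimage_le/measurable_jump_time.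
exact/measurable_preimage_gt/measurable_jump_time.
Qed.

End measurability.

Definition first_step D Y T j i a b : set Omega := D `&`
  ([set w | Y 0%N w = j] `&` [set w | Y 1%N w = i] `&`
   [set w | a < T 0%N w] `&` [set w | T 0%N w <= b]).

Lemma measurable_first_step D Y T j i a b c : path_law D Y T j c ->
  measurable (first_step D Y T j i a b).
Proof.
move=> [mD mYT _ _ _]; have [mY0 mT0] := mYT 0%N; have [mY1 _] := mYT 1%N.
apply: measurableI => //; apply: measurableI; last exact: measurable_preimage_le.
apply: measurableI; last exact: measurable_preimage_gt.
by apply: measurableI; exact: measurable_preimage_nat.
Qed.

(** Prefixing a shifted cylinder with the state [j] and a lower bound on [T 0] gives a cylinder of
    the original path. The window [a < T 0 <= b] is a difference of two such cylinders, whose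
    product laws share all factors but the exponential in [a] or [b]. *)
Lemma path_law_first_step D Y T j i c (a b : R) :
  path_law D Y T j c -> 0 <= a -> a <= b ->
  path_law (first_step D Y T j i a b) (shift Y) (shift T) i
    (c * jump_prob q j i * (expR (- exit_rate q j * a) - expR (- exit_rate q j * b))).
Proof.
move=> DL a0 ab; have [mD mYT T0 PD DE] := DL.
have mS := measurable_first_step i a b DL.
have key k y s : (forall m, 0 <= s m) ->
    P (first_step D Y T j i a b `&` cylinder (shift Y) (shift T) k y s) =
    (c * jump_prob q j i * (expR (- exit_rate q j * a) - expR (- exit_rate q j * b)) *
      cylinder_law i k y s)%:E.
  (* If [y 0] differs from [i], the event is empty and the claimed law is 0. *)
  move=> s0; have [yi|yi] := eqVneq (y 0%N) i; last first.
    rewrite /cylinder_law (negbTE yi) !mul0r mulr0 (_ : _ `&` _ = set0) ?measure0//.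
    apply/seteqP; split => // w [[_ [[[_ /= Y1] _] _]] /(_ 0%N isT)[]].
    by rewrite /shift Y1 => iy; rewrite iy eqxx in yi.
  (* [y'] and [s' x] prepend the state [j] and the threshold [x]. *)
  pose y' m := if m is m'.+1 then y m' else j.
  pose s' x m := if m is m'.+1 then s m' else x.
  have cylE x : 0 <= x -> P (D `&` cylinder Y T k.+1 y' (s' x)) =
      (c * jump_prob q j i * expR (- exit_rate q j * x) * cylinder_law i k y s)%:E.
    move=> x0; rewrite DE; last by case.
    congr EFin; rewrite /cylinder_law/= eqxx yi eqxx !mul1r.
    rewrite big_ord_recl/= [X in _ * (_ * X)]big_ord_recl/= yi mulNr.
    by ring.
  have -> : first_step D Y T j i a b `&` cylinder (shift Y) (shift T) k y s =
      (D `&` cylinder Y T k.+1 y' (s' a)) `\` (D `&` cylinder Y T k.+1 y' (s' b)).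
    apply/seteqP; split => w.
      move=> [[Dw [[[/= Y0 Y1] aT] Tb]] C]; split.
        split => // -[_|m]/=; first by [].
        by rewrite ltnS => /C.
      move=> [_ /(_ 0%N isT)[_ /=]].
      by rewrite ltNge Tb.
    move=> [[Dw C] /not_andP[//|C']]; split; last first.
      by move=> m mk; have := C m.+1 mk.
    have [Y0 aT] := C 0%N isT; have [Y1 _] := C 1%N isT.
    split => //; split; last first.
      rewrite /= leNgt; apply/negP => bT; apply: C' => -[_|m mk]//.
      by have := C m.+1 mk.
    by split => //; split => //=; rewrite Y1/= yi.
  set A := D `&` _; set B := D `&` _.
  have mA : measurable A by exact/measurableI/measurable_cylinder.
  have mB : measurable B by exact/measurableI/measurable_cylinder.
  have -> : P (A `\` B) = (P A - P (A `&` B))%E.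
    by apply: measureD => //; exact: le_lt_trans (probability_le1 P mA) (ltry 1).
  rewrite (_ : A `&` B = B); last first.
    apply/setIidr => w [Dw C]; split => // m mk; have [Ym sT] := C m mk.
    split => //; case: m {mk Ym} sT => //=; exact: le_lt_trans.
  by rewrite /A /B !cylE ?(le_trans a0 ab)// -EFinB; congr EFin; ring.
split => //.
- by move=> k; exact: mYT.
- by move=> k w; exact: T0.
(* The total mass is [key] for the cylinder with [k = 0] and threshold 0, which contains the whole
   event because holding times are positive. *)
- have := key 0%N (fun=> i) (fun=> 0) (fun=> lexx 0).
  rewrite /cylinder_law eqxx big_ord0 big_ord_recl big_ord0 mulr0 oppr0 expR0 !mulr1.
  move=> <-; congr (P _); apply/esym/setIidl => w [_ [[[_ Y1] _] _]] m /=.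
  by rewrite leqn0 => /eqP ->; split => //; exact: T0.
Qed.

End path_law.

(** * Splitting at the first jump, and right-continuity of paths *)

Section first_jump.
Context {R : realType} d (Omega : measurableType d) (P : probability Omega R).
Variables (r : nat) (q : nat -> nat -> R).
Hypothesis qP : skip_free r q.
Implicit Types (D : set Omega) (Y : nat -> Omega -> nat)
  (T : nat -> Omega -> R).

Lemma hitS Y T K n t w : (forall k w, 0 < T k w) -> 0 <= t ->
  hit Y T K.+1 n t w <->
  (t < T 0%N w /\ Y 0%N w = n) \/
  (T 0%N w <= t /\ hit (shift Y) (shift T) K n (t - T 0%N w) w).
Proof.
move=> T0 t0.
have T0' k w' : 0 < shift T k w' by exact: T0.
split.
  move=> [[|k] [kK Yk]]; rewrite jump_timeS.
    rewrite [jump_time (shift T) 0 w]big_ord0 addr0 => /andP[_ tT].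
    by left.
  rewrite jump_timeS => /andP[J1 J2]; right; split.
    by rewrite (le_trans _ J1)// lerDl jump_time_ge0.
  by exists k; split => //; rewrite lerBrDl J1 ltrBlDl.
move=> [[tT Yn]|[Tt [k [kK Yk /andP[J1 J2]]]]].
  exists 0%N; split => //; rewrite jump_timeS /jump_time !big_ord0 t0.
  by rewrite addr0.
by exists k.+1; split => //; rewrite !(jump_timeS T) -lerBrDl J1 -ltrBlDl.
Qed.

Lemma le_right_constant (x v : R) :
  exists2 e, 0 < e & forall u, v <= u <= v + e -> (x <= u) = (x <= v).
Proof.
have [xv|vx] := leP x v.
  by exists 1 => // u /andP[vu _]; rewrite (le_trans xv vu).
exists ((x - v) / 2); first by rewrite divr_gt0// subr_gt0.
by move=> u /andP[vu uv]; apply/negbTE; rewrite -ltNge; lra.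
Qed.

(** Right-continuity of the paths: passing from [K] to [K.+1] involves only two more jump times, and
    each comparison of [u] with a fixed jump time is constant for [u] just to the right of [v]. *)
Lemma hit_right_constant Y T K n v w :
  exists2 e, 0 < e &
    forall u, v <= u <= v + e -> hit Y T K n u w <-> hit Y T K n v w.
Proof.
elim: K => [|K [e e0 IH]].
  by exists 1 => // u _; split => -[k []].
have [e1 e10 H1] := le_right_constant (jump_time T K w) v.
have [e2 e20 H2] := le_right_constant (jump_time T K.+1 w) v.
exists (Num.min e (Num.min e1 e2)); first by rewrite !lt_min e0 e10.
move=> u /andP[vu].
rewrite -lerBlDl !le_min !lerBlDl => /and3P[ue ue1 ue2].
have split_hit x : hit Y T K.+1 n x w <-> hit Y T K n x w \/
    Y K w = n /\ jump_time T K w <= x < jump_time T K.+1 w.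
  split.
    move=> [k [+ Yk Jk]]; rewrite ltnS leq_eqVlt => /predU1P[kK|kK].
      by right; rewrite -kK.
    by left; exists k.
  move=> [[k [kK Yk Jk]]|[YK JK]]; last by exists K.
  by exists k; split => //; exact: ltnW.
apply: (iff_trans (split_hit u)); apply: (iff_trans _ (iff_sym (split_hit v))).
have := IH u; rewrite vu ue => /(_ isT) hE.
rewrite !ltNge H1 ?vu// H2 ?vu//.
by split=> -[/hE|]; [left|right|left|right].
Qed.

Lemma sum_jump_prob j : (r <= j)%N -> \sum_(i < j.+2) jump_prob q j i = 1.
Proof.
have [_ _ _ _ Q0] := qP; move=> rj.
under eq_bigr do rewrite (jump_probE qP)//.
by rewrite -mulr_suml divff// gt_eqF// Q0.
Qed.

(** The jump probabilities from [j] to the states up to [j.+1] already sum to 1, so on [D] the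
    events fixing [Y 0] and [Y 1] exhaust the mass. *)
Lemma path_law_total D Y T j c (A : set Omega) : path_law P q D Y T j c ->
  (r <= j)%N -> measurable A ->
  P (D `&` A) = (\sum_(i < j.+2)
    P (D `&` ([set w | Y 0%N w = j] `&` [set w | Y 1%N w = i]) `&` A))%E.
Proof.
move=> [mD mYT T0 PD DE] rj mA.
pose F (i : nat) := D `&` ([set w | Y 0%N w = j] `&` [set w | Y 1%N w = i]).
have mF i : measurable (F i).
  have [mY0 _] := mYT 0%N; have [mY1 _] := mYT 1%N.
  by apply: measurableI => //; apply: measurableI; exact: measurable_preimage_nat.
have PF i : P (F i) = (c * jump_prob q j i)%:E.
  have := DE 1%N (fun m => if m is 0%N then j else i) (fun=> 0) (fun=> lexx 0).
  rewrite /cylinder_law eqxx !big_ord_recl !big_ord0 !mulr0 oppr0 expR0 !mulr1 mul1r.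
  move=> <-; congr (P _); rewrite /F; congr (_ `&` _); apply/seteqP; split => w /=.
    by move=> [Y0 Y1] [|[|//]] _; split => //; exact: T0.
  by move=> C; have [? _] := C 0%N isT; have [? _] := C 1%N isT.
have tF : trivIset setT F.
  by move=> i k _ _ [w [[_ [_ /= Yi]] [_ [_ /= Yk]]]]; rewrite -Yi -Yk.
have bigE (B : nat -> set Omega) : (forall i, measurable (B i)) -> trivIset setT B ->
    P (\big[setU/set0]_(i < j.+2) B i) = (\sum_(i < j.+2) P (B i))%E.
  move=> mB tB; apply: (measure_semi_additive_ord_I P) => //.
    exact: sub_trivIset tB.
  exact: bigsetU_measurable.
pose G := \big[setU/set0]_(i < j.+2) F i.
have mG : measurable G by exact: bigsetU_measurable.
have PG : P G = P D.
  rewrite /G bigE// PD; under eq_bigr do rewrite PF.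
  by rewrite sumEFin -mulr_sumr sum_jump_prob// mulr1.
have GD : G `<=` D by rewrite /G -bigcup_mkord => w [i _ []].
(* The part of [D] outside the union [G] of the [F i] is null, hence so is its intersection with
   [A]. *)
have PDG : P (D `\` G) = 0%E.
  have -> : P (D `\` G) = (P D - P (D `&` G))%E.
    by apply: measureD => //; exact: le_lt_trans (probability_le1 P mD) (ltry 1).
  by rewrite (setIidr GD) PG PD -EFinB subrr.
have -> : P (D `&` A) = (P (D `&` A `\` G) + P (D `&` A `&` G))%E.
  by apply: measureDI => //; exact: measurableI.
rewrite [X in (X + _)%E](_ : _ = 0%E) ?add0e; last first.
  apply: (@subset_measure0 _ _ _ P _ (D `\` G)) => //.
  - by apply: measurableD => //; exact: measurableI.
  - exact: measurableD.
  - by move=> w [[? ?] ?].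
transitivity (P (\big[setU/set0]_(i < j.+2) (F i `&` A))); last first.
  apply: (bigE (fun i => F i `&` A)) => [i|]; first exact: measurableI.
  by move=> i k _ _ [w [[Fi _] [Fk _]]]; apply: tF => //; exists w.
congr (P _); rewrite -big_distrl/= -/G setIAC; congr (_ `&` _).
exact: setIidr.
Qed.

End first_jump.

(** * The iterates [bwd] as probabilities of [hit] events *)

Section backward_prob.
Context {R : realType} d (Omega : measurableType d) (P : probability Omega R).
Variables (r : nat) (q : nat -> nat -> R).
Hypothesis qP : skip_free r q.
Implicit Types (D : set Omega) (Y : nat -> Omega -> nat)
  (T : nat -> Omega -> R).

(** Quantified over [D], [Y], [T] and [c] so that the induction on [K] can apply it to the shifted
    path restricted to a first-step event. *)
Definition hit_law K n := forall D Y T j c (t : R), path_law P q D Y T j c ->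
  (r <= j)%N -> 0 <= t -> P (D `&` hit Y T K n t) = (c * bwd q K j n t)%:E.

Definition slab D T (a b : R) (A : set Omega) : set Omega :=
  D `&` ([set w | a < T 0%N w] `&` [set w | T 0%N w <= b] `&` A).

Lemma measurable_slab D Y T j c a b A : path_law P q D Y T j c ->
  measurable A -> measurable (slab D T a b A).
Proof.
move=> [mD mYT _ _ _] mA; have [_ mT] := mYT 0%N.
apply: measurableI => //; apply: measurableI => //; apply: measurableI.
  exact: measurable_preimage_gt.
exact: measurable_preimage_le.
Qed.

(** Split by the state [Y 1]: on each piece the shifted path follows the chain started there, so
    [hit_law] applies at the fixed time [u]. Pieces with [i < r] are null. *)
Lemma slab_hit K n D Y T j c (a b u : R) : hit_law K n ->
  path_law P q D Y T j c -> (r <= j)%N -> 0 <= a -> a <= b -> 0 <= u ->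
  P (slab D T a b (hit (shift Y) (shift T) K n u)) =
  (c * (expR (- out_rate q j * a) - expR (- out_rate q j * b)) *
    \sum_(i < j.+2) jump_prob q j i * bwd q K i n u)%:E.
Proof.
move=> IH DL rj a0 ab u0; have [mD mYT T0 PD DE] := DL.
have [_ _ _ qlow _] := qP.
have [_ mT0] := mYT 0%N.
have mH : measurable (hit (shift Y) (shift T) K n u).
  by apply: measurable_hit => k; exact: mYT.
rewrite /slab (path_law_total qP DL rj); last first.
  apply: measurableI => //; apply: measurableI.
    exact: measurable_preimage_gt.
  exact: measurable_preimage_le.
rewrite mulr_sumr -sumEFin; apply: eq_bigr => i _.
have := path_law_first_step i DL a0 ab; rewrite (exit_rateE qP)// => FL.
have -> : D `&` ([set w | Y 0%N w = j] `&` [set w | Y 1%N w = i]) `&`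
    ([set w | a < T 0%N w] `&` [set w | T 0%N w <= b] `&`
      hit (shift Y) (shift T) K n u) =
    first_step D Y T j i a b `&` hit (shift Y) (shift T) K n u.
  by rewrite /first_step !setIA.
have [ri|ir] := leqP r i.
  by rewrite (IH _ _ _ _ _ _ FL)//; congr EFin; ring.
move: FL; rewrite (jump_probE qP)// qlow// !(mul0r, mulr0) => FL.
have [mF _ _ PF _] := FL.
by apply: (@subset_measure0 _ _ _ P _ _ _ mF) => //; exact: measurableI.
Qed.

Lemma slab_index (s t : R) N : 0 < s -> s <= t ->
  exists2 l, (l < N.+1)%N &
    l%:R * (t / N.+1%:R) < s <= l.+1%:R * (t / N.+1%:R).
Proof.
move=> s0 st; set h := t / _.
have Nh : N.+1%:R * h = t by rewrite /h mulrC divfK// pnatr_eq0.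
have ex : exists m, s <= m%:R * h by exists N.+1; rewrite Nh.
case: (ex_minnP ex) => -[|m]; first by rewrite mul0r leNgt s0.
move=> sm mmin; exists m; first by apply: mmin; rewrite Nh.
rewrite sm andbT ltNge; apply/negP => /mmin.
by rewrite ltnn.
Qed.

(* The first holding time is discretised: on l h < T 0 <= (l + 1) h the
   remaining time t - T 0 is replaced by t - l h.  As paths are right-continuous
   the resulting events converge, and their probabilities are Riemann sums. *)
Lemma hit_lawS K n : hit_law K n -> hit_law K.+1 n.
Proof.
move=> IH D Y T j c t DL rj t0; have [mD mYT T0 PD DE] := DL.
have [q0 _ _ qlow Qgt0] := qP.
set Q := out_rate q j; have Q0 : 0 < Q by exact: Qgt0.
have [mY0 mT0] := mYT 0%N.
have mYT' k : measurable_fun setT (shift Y k) /\ measurable_fun setT (shift T k).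
  exact: mYT.
pose H u := hit (shift Y) (shift T) K n u.
(* [g u] averages the level-[K] iterate over the state entered at the first jump; [f] removes from
   [bwd] the contribution of paths without a jump. *)
pose g u := \sum_(i < j.+2) jump_prob q j i * bwd q K i n u.
pose f u := bwd q K.+1 j n u - (j == n)%:R * expR (- Q * u).
(* [E1] has no jump up to time [t], [E2] at least one. *)
pose E1 := D `&` ([set w | Y 0%N w = n] `&` [set w | t < T 0%N w]).
pose E2 := (D `&` hit Y T K.+1 n t) `\` [set w | t < T 0%N w].
pose S N l := slab D T (l%:R * (t / N.+1%:R)) (l.+1%:R * (t / N.+1%:R))
    (H (t - l%:R * (t / N.+1%:R))).
pose F N := \bigcup_(l < N.+1) S N l.
have mgt : measurable [set w | t < T 0%N w] by exact: measurable_preimage_gt.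
have mE : measurable (D `&` hit Y T K.+1 n t).
  by apply: measurableI => //; exact: measurable_hit.
have mE2 : measurable E2 by exact: measurableD.
have mS N l : measurable (S N l).
  by apply: measurable_slab DL _; exact: measurable_hit.
have mF N : measurable (F N) by apply: bigcup_measurable => l _; exact: mS.
have E1E : E1 = D `&` cylinder Y T 0 (fun=> n) (fun=> t).
  congr (_ `&` _); apply/seteqP; split => w.
    by move=> [/= Yn tT] m; rewrite leqn0 => /eqP ->.
  by move=> C; have [] := C 0%N isT.
have PE1 : P E1 = (c * ((j == n)%:R * expR (- Q * t)))%:E.
  rewrite E1E DE// /cylinder_law big_ord0 big_ord_recl big_ord0 !mulr1 eq_sym.
  have [<-|jn] := eqVneq j n; last by rewrite !mul0r.
  by rewrite (exit_rateE qP)// -mulNr.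
have E12 : P (D `&` hit Y T K.+1 n t) = (P E1 + P E2)%E.
  rewrite addeC; rewrite (measureDI P mE mgt); congr (_ + P _)%E.
  apply/seteqP; split => w.
    move=> [[Dw /(hitS _ _ _ _ T0 t0)[[tT Yn]|[Tt _]]] /= tT'].
      by split.
    by rewrite ltNge Tt in tT'.
  move=> [Dw [Yn tT]]; split => //; split => //.
  by apply/(hitS _ _ _ _ T0 t0); left.
have PF N : P (F N) = (c * \sum_(l < N.+1)
    (expR (- Q * (l%:R * (t / N.+1%:R))) - expR (- Q * (l.+1%:R * (t / N.+1%:R))))
      * g (t - l%:R * (t / N.+1%:R)))%:E.
  have h0 : 0 <= t / N.+1%:R by rewrite divr_ge0.
  rewrite /F bigcup_mkord.
  transitivity (\sum_(l < N.+1) P (S N l))%E.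
    apply: (measure_semi_additive_ord_I P (F := S N)) => //; last first.
      exact: bigsetU_measurable.
    move=> l m _ _ [w [[_ [[/= l1 l2] _]] [_ [[/= m1 m2] _]]]].
    apply/eqP; rewrite eqn_leq -ltnS -[X in _ && X]ltnS; apply/andP; split.
      rewrite ltnNge; apply/negP => ml; have := lt_le_trans l1 m2.
      by rewrite ltNge ler_wpM2r// ler_nat.
    rewrite ltnNge; apply/negP => ml; have := lt_le_trans m1 l2.
    by rewrite ltNge ler_wpM2r// ler_nat.
  rewrite mulr_sumr -sumEFin; apply: eq_bigr => l _.
  rewrite /S (slab_hit IH DL rj)//.
  - by congr EFin; rewrite [RHS]mulrA.
  - by rewrite mulr_ge0.
  - by rewrite ler_wpM2r// ler_nat.
  - rewrite subr_ge0 mulrCA ler_piMr//.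
    by rewrite ler_pdivrMr// mul1r ler_nat ltnW.
(* For each path, [F N] and [E2] agree once the mesh is at most the length [e] on which [hit] is
   constant to the right of [t - T 0]. *)
have cvF : P (F N) @[N --> \oo] --> P E2.
  apply: cvg_measure_eventually => // w.
  have [Dw|nDw] := pselect (D w); last first.
    by apply: nearW => N; split; [move=> [l _ []]|move=> [[]]].
  have [tT|Tt] := ltP t (T 0%N w).
    apply: nearW => N; split => [[l lN [_ [[_ /= Tl] _]]]|[_ /(_ tT)]//].
    have : l.+1%:R * (t / N.+1%:R) <= t.
      rewrite mulrCA ler_piMr//.
      by rewrite ler_pdivrMr// mul1r ler_nat.
    by move=> /(le_trans Tl); rewrite leNgt tT.
  have [e e0 He] := hit_right_constant (shift Y) (shift T) K n (t - T 0%N w) w.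
  have h0 : t * N.+1%:R^-1 @[N --> \oo] --> (0 : R).
    rewrite -(mulr0 t); apply: cvgM; first exact: cvg_cst.
    exact: cvg_harmonic.
  have E2w : E2 w <-> H (t - T 0%N w) w.
    split.
      by move=> [[_ /(hitS _ _ _ _ T0 t0)[[tT _] /(_ tT)|[]]]].
    move=> Hw; split; last by rewrite /= ltNge Tt.
    by split => //; apply/(hitS _ _ _ _ T0 t0); right.
  move/cvgrPdist_le: h0 => /(_ _ e0); apply: filterS => N.
  rewrite sub0r normrN ger0_norm; last by rewrite mulr_ge0.
  move=> he; apply: (iff_trans _ (iff_sym E2w)).
  have close (l : nat) : l%:R * (t / N.+1%:R) < T 0%N w <= l.+1%:R * (t / N.+1%:R) ->
      t - T 0%N w <= t - l%:R * (t / N.+1%:R) <= t - T 0%N w + e.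
    move: he; rewrite -[l.+1]addn1 natrD mulrDl mul1r.
    by move: (l%:R * _) => x; move: (t / _) => y; lra.
  split.
    move=> [l lN [_ [[/= l1 l2] Hl]]].
    by apply: (He _ (close l _)).1 => //; rewrite l1 l2.
  have [l lN ll] := slab_index N (T0 0%N w) Tt.
  move=> Hw; exists l => //; split => //; split.
    by have /andP[] := ll.
  exact: (He _ (close l ll)).2.
have df s : 0 <= s <= t -> is_derive s 1 f (- Q * f s + Q * g s).
  move=> /andP[s0 _].
  apply: is_derive_eqP (is_derive_subf (bwd_derive q K j n s0)
    (is_derive_scalef (j == n)%:R (is_derive_expRM (- Q) s))).
  have -> : \sum_(i < j.+2) q j i * bwd q K i n s = Q * g s.
    rewrite /g mulr_sumr; apply: eq_bigr => i _.
    rewrite (jump_probE qP)// -/Q mulrA; congr (_ * _).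
    by rewrite mulrC divfK// gt_eqF.
  by rewrite /f -/Q; move: (bwd q K.+1 j n s) => x; ring.
(* The Lipschitz constant of [g] averages the exit rates of the next state. The value 0 below [r] is
   harmless because [jump_prob q j i] vanishes there. *)
pose L := \sum_(i < j.+2) jump_prob q j i * (if (r <= i)%N then out_rate q i else 0).
have jp0 i : 0 <= jump_prob q j i.
  by rewrite (jump_probE qP)// divr_ge0 ?q0// ltW.
have gL u v : 0 <= u -> u <= v -> v <= t -> `|g v - g u| <= L * (v - u).
  move=> u0 uv _; rewrite /g /L -sumrB mulr_suml.
  apply: (le_trans (ler_norm_sum _ _ _)); apply: ler_sum => i _.
  rewrite -mulrBr normrM (ger0_norm (jp0 i)) -mulrA.
  have [ri|ir] := leqP r i; first by rewrite ler_wpM2l// (bwd_lipschitz qP).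
  by rewrite (jump_probE qP)// qlow// !mul0r.
have L0 : 0 <= L.
  apply: sumr_ge0 => i _; rewrite mulr_ge0//; case: ifPn => // ri.
  by rewrite ltW// Qgt0.
have f0 : f 0 = 0 by rewrite /f bwd0 mulr0 expR0 mulr1 subrr.
have cvS := riemann_cvg t0 (ltW Q0) L0 df gL f0.
have PE2 : P E2 = (c * f t)%:E.
  move: cvF; rewrite (funext PF) => cvF.
  apply: (cvg_unique _ cvF) => //.
  apply: cvg_EFin; first exact: nearW.
  apply: cvgM => //; exact: cvg_cst.
by rewrite E12 PE1 PE2 -EFinD; congr EFin; rewrite /f; ring.
Qed.

End backward_prob.

(** * Transition probabilities as limits of the iterates *)

Section transition_probabilities.
Context {R : realType} d (Omega : measurableType d).
Variables (r : nat) (q : nat -> nat -> R).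
Hypothesis qP : skip_free r q.

Lemma path_law_hit (P : probability Omega R) K n : hit_law P r q K n.
Proof.
elim: K => [|K IH]; last exact: hit_lawS.
move=> D Y T j c t _ _ _; rewrite mulr0.
rewrite (_ : _ `&` _ = set0) ?measure0//.
by apply/seteqP; split => // w [_ [k []]].
Qed.

Variables (P : nat -> probability Omega R) (X : R -> Omega -> option nat).
Hypothesis X_ctmc : is_ctmc [set n | (r <= n)%N] q P X.

(** Continuity from below: the events [hit Y T K n t] increase with [K] to [X t = Some n]. *)
Lemma cvg_bwd_trans_prob j n t : (r <= j)%N -> 0 <= t ->
  bwd q K j n t @[K --> \oo] --> trans_prob P X j n t.
Proof.
move=> rj t0; have [Y [T [mYT T0 law XE]]] := X_ctmc.
have init : path_law (P j) q setT Y T j 1.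
  split => //; first exact: probability_setT.
  move=> k y s s0; rewrite setTI mul1r -(law j rj k y s s0).
  by congr (P j _).
have PE K : P j (hit Y T K n t) = (bwd q K j n t)%:E.
  by have := path_law_hit K n init rj t0; rewrite setTI mul1r.
have mH K : measurable (hit Y T K n t) by exact: measurable_hit.
have HE : [set w | X t w = Some n] = \bigcup_K hit Y T K n t.
  apply/seteqP; split => w.
    by move=> /(XE t t0 w n)[k [Yk Jk]]; exists k.+1 => //; exists k.
  by move=> [K _ [k [_ Yk Jk]]]; apply/(XE t t0 w n); exists k.
rewrite /trans_prob HE.
have PU : P j (\bigcup_K hit Y T K n t) \is a fin_num.
  by apply: fin_num_measure; exact: bigcup_measurable.
have -> : (fun K => bwd q K j n t) = fine \o (P j \o (fun K => hit Y T K n t)).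
  by apply/funext => K; rewrite /= PE.
apply: fine_cvg; rewrite fineK//.
apply: nondecreasing_cvg_mu => //; first exact: bigcup_measurable.
move=> K K' KK'; apply/subsetPset => w [k [kK Yk Jk]].
by exists k; split => //; exact: leq_trans KK'.
Qed.

Lemma trans_prob_itv j n t : (r <= j)%N -> 0 <= t ->
  0 <= trans_prob P X j n t <= 1.
Proof.
move=> rj t0; have cv := cvg_bwd_trans_prob (n := n) rj t0.
apply/andP; split.
  by apply: (cvgr_ge_cst cv) => K; have /andP[] := bwd_itv qP K n rj t0.
by apply: (cvgr_le_cst cv) => K; have /andP[] := bwd_itv qP K n rj t0.
Qed.

End transition_probabilities.

(** * The backward equation in the limit *)

Section backward_equation.
Context {R : realType}.
Variables (r : nat) (q : nat -> nat -> R).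
Hypothesis qP : skip_free r q.

(** Nothing is known of [p] at negative times, so a version [p'] with a two-sided derivative at 0 is
    built by variation of constants. Letting [K] grow in the recursion for [bwd] shows that it
    agrees with [p]. *)
Lemma backward_equation n (p : nat -> R -> R) :
  (forall j (t : R), (r <= j)%N -> 0 <= t ->
    bwd q K j n t @[K --> \oo] --> p j t) ->
  exists p' : nat -> R -> R,
    [/\ forall j (t : R), (r <= j)%N -> 0 <= t -> p' j t = p j t,
        forall j, (r <= j)%N -> p' j 0 = (j == n)%:R,
        forall j (t : R), (r <= j)%N -> 0 <= t -> 0 <= p' j t <= 1 &
        forall j (t : R), (r <= j)%N -> 0 <= t -> is_derive t 1 (p' j)
          (- out_rate q j * p' j t + \sum_(i < j.+2) q j i * p' i t)].
Proof.
move=> bwdp; have [q0 _ _ qlow Q0] := qP.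
have p01 j t : (r <= j)%N -> 0 <= t -> 0 <= p j t <= 1.
  move=> rj t0; have cv := bwdp j t rj t0.
  apply/andP; split.
    by apply: (cvgr_ge_cst cv) => K; have /andP[] := bwd_itv qP K n rj t0.
  by apply: (cvgr_le_cst cv) => K; have /andP[] := bwd_itv qP K n rj t0.
pose h j s := \sum_(i < j.+2) q j i * p i s.
pose p' j t := expR (- out_rate q j * t) * ((j == n)%:R +
  prim (fun s => expR (out_rate q j * s) * h j s) t).
(* The Lipschitz bound, uniform in [K], makes the limit continuous. *)
have cp i : (r <= i)%N -> continuous (fun s : R => p i (Num.max 0 s)).
  move=> ri; apply: (continuous_max0_lipschitz (ltW (Q0 _ ri))) => u v u0 uv.
  have v0 := le_trans u0 uv.
  have cv : `|bwd q K i n v - bwd q K i n u| @[K --> \oo] --> `|p i v - p i u|.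
    by apply: cvg_norm; apply: cvgB; exact: bwdp.
  apply: (cvgr_le_cst cv) => K.
  exact: (bwd_lipschitz qP).
have ch j : (r <= j)%N -> continuous (fun s : R => h j (Num.max 0 s)).
  move=> rj s; apply: (@cvgr_sum R _ _ _ _ _
    (fun (i : 'I_j.+2) s => q j i * p i (Num.max 0 s))) => i.
  have [ri|ir] := leqP r i.
    by apply: cvgM; [exact: cvg_cst|exact: cp].
  by rewrite qlow//; under eq_fun do rewrite mul0r; rewrite mul0r; exact: cvg_cst.
have p'p j t : (r <= j)%N -> 0 <= t -> p' j t = p j t.
  move=> rj t0.
  have cvS : bwd q K.+1 j n t @[K --> \oo] --> p j t.
    by have := bwdp j t rj t0; rewrite -cvg_shiftS.
  apply/esym/(cvg_unique _ cvS) => //.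
  apply: cvgM; first exact: cvg_cst.
  apply: cvgD; first exact: cvg_cst.
  have sum_itv K s : 0 <= s -> 0 <= \sum_(i < j.+2) q j i * bwd q K i n s <= out_rate q j.
    move=> s0; apply: (sum_rate_itv qP (x := fun i => bwd q K i n s)) => // i ri.
    exact: (bwd_itv qP).
  (* The dominating constant bounds the exponential by its value at [t] and the sum by
     [out_rate q j]. *)
  apply: (@prim_cvg R _ _ t (expR (out_rate q j * t) * out_rate q j)) => //.
  - move=> K; apply: (@continuous_max0 R (fun s => expR (out_rate q j * s) *
      \sum_(i < j.+2) q j i * bwd q K i n s)) => s s0.
    apply: cvgM; first exact: (is_derive_continuous (is_derive_expRM _ _)).
    by apply: cvgr_sum => i; apply: cvgM; [exact: cvg_cst|exact: bwd_continuous].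
  - move=> s; apply: cvgM; last exact: ch.
    apply: (@continuous_max0 R (fun s => expR (out_rate q j * s))) => x _.
    exact: (is_derive_continuous (is_derive_expRM _ _)).
  - move=> s /andP[s0 st]; apply: cvgM; first exact: cvg_cst.
    apply: cvgr_sum => i; have [ri|ir] := leqP r i.
      by apply: cvgM; [exact: cvg_cst|exact: bwdp].
    by rewrite qlow//; under eq_fun do rewrite mul0r; rewrite mul0r; exact: cvg_cst.
  - move=> K s /andP[s0 st]; have /andP[S0 S1] := sum_itv K s s0.
    rewrite normrM (ger0_norm (expR_ge0 _)) (ger0_norm S0).
    by rewrite ler_pM// ?expR_ge0// ler_expR ler_wpM2l// ltW// Q0.
exists p'; split => //.
- by move=> j rj; rewrite /p' prim0 mulr0 expR0 mul1r addr0.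
- by move=> j t rj t0; rewrite p'p// p01.
- move=> j t rj t0.
  have -> : \sum_(i < j.+2) q j i * p' i t = h j t.
    apply: eq_bigr => i _; have [ri|ir] := leqP r i; first by rewrite p'p.
    by rewrite qlow// !mul0r.
  by apply: is_derive_linear_ode => //; exact: ch.
Qed.

End backward_equation.

(** * Comparison of bounded solutions with the iterates *)

Section comparison.
Context {R : realType}.
Variables (r : nat) (q : nat -> nat -> R).
Hypothesis qP : skip_free r q.

(** A minimum principle by induction on [K]: the right-hand side plus or minus [V - bwd] obeys the
    same recursion in [K] as [bwd], with nonnegative initial values. At [K = 0] it is [C] plus or
    minus [V]. *)
Lemma bwd_comparison n M (C T : R) (V : nat -> R -> R) :
  (forall j t, (r <= j)%N -> 0 <= t <= T -> `|V j t| <= C) ->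
  (forall j, (r <= j)%N -> V j 0 = (j == n)%:R) ->
  (forall j (t : R), (r <= j)%N -> 0 <= t <= T -> is_derive t 1 (V j)
     (- out_rate q j * V j t + \sum_(i < j.+2) q j i * V i t)) ->
  forall K j t, (r <= j)%N -> 0 <= t <= T ->
  `|V j t - bwd q K j n t| <= C * (1 - \sum_(r <= m < M) bwd q K j m t).
Proof.
move=> VC V0 dV.
suff key e K j t : `|e| <= 1 -> (r <= j)%N -> 0 <= t <= T ->
    0 <= C * (1 - \sum_(r <= m < M) bwd q K j m t) + e * (V j t - bwd q K j n t).
  move=> K j t rj tT; rewrite ler_norml; apply/andP; split.
    by have := key 1 K j t _ rj tT; rewrite normr1 lexx => /(_ isT); lra.
  by have := key (-1) K j t _ rj tT; rewrite normrN1 lexx => /(_ isT); lra.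
move=> e1; have C0 i s : (r <= i)%N -> 0 <= s <= T -> 0 <= C.
  by move=> ri sT; exact: le_trans (VC i s ri sT).
elim: K j t => [|K IH] j t rj tT.
  rewrite big1// subr0 mulr1 subr0.
  have : `|e * V j t| <= C.
    by rewrite normrM -[leRHS]mul1r ler_pM// VC.
  by rewrite ler_norml => /andP[+ _]; lra.
pose x i s := C * (1 - \sum_(r <= m < M) bwd q K i m s) + e * (V i s - bwd q K i n s).
apply: (@linear_ode_ge0 _ (fun s => C * (1 - \sum_(r <= m < M) bwd q K.+1 j m s) +
   e * (V j s - bwd q K.+1 j n s))
  (fun s => C * (0 - \sum_(r <= m < M)
      (- out_rate q j * bwd q K.+1 j m s + \sum_(i < j.+2) q j i * bwd q K i m s)) +
    e * ((- out_rate q j * V j s + \sum_(i < j.+2) q j i * V i s) -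
      (- out_rate q j * bwd q K.+1 j n s + \sum_(i < j.+2) q j i * bwd q K i n s)))
  (out_rate q j) T) => //.
- move=> s sT; have /andP[s0 _] := sT.
  have dsum := is_derive_sumf (index_iota r M)
    (fun m => bwd_derive q K j m s0).
  exact: is_derive_addf
    (is_derive_scalef C (is_derive_subf (is_derive_cstf 1 s) dsum))
    (is_derive_scalef e (is_derive_subf (dV j s rj sT) (bwd_derive q K j n s0))).
- move=> s sT.
  (* The exit-rate terms cancel, leaving the rate-weighted sum of the level-[K] quantities [x i s],
     nonnegative by induction. *)
  rewrite [leRHS](_ : _ = \sum_(i < j.+2) q j i * x i s).
    have := @ler_sum_rate _ _ _ qP j (fun=> 0) (x ^~ s) rj.
    rewrite big1; first by apply => i ri; exact: IH.
    by move=> i _; rewrite mulr0.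
  have -> : \sum_(i < j.+2) q j i * x i s =
      C * (out_rate q j - \sum_(r <= m < M) \sum_(i < j.+2) q j i * bwd q K i m s)
      + e * (\sum_(i < j.+2) q j i * V i s - \sum_(i < j.+2) q j i * bwd q K i n s).
    rewrite exchange_big/= /out_rate -!sumrB !mulr_sumr -big_split/=.
    by apply: eq_bigr => i _; rewrite /x -mulr_sumr; ring.
  have sumE (a b : nat -> R) : \sum_(r <= m < M) (- out_rate q j * a m + b m) =
      - out_rate q j * \sum_(r <= m < M) a m + \sum_(r <= m < M) b m.
    by rewrite big_split/= -mulr_sumr.
  rewrite (sumE (fun m => bwd q K.+1 j m s)).
  move: (bwd q K.+1 j n s) (\sum_(r <= m < M) bwd q K.+1 j m s) => y5 y1.
  by ring.
(* At time 0, [V] and [bwd] agree, and the indicators of [j == m] over distinct [m] sum to at most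
   1. *)
- rewrite V0// bwd0 subrr mulr0 addr0 mulr_ge0 ?(C0 j t)// subr_ge0.
  under eq_bigr do rewrite bwd0.
  have [jM|jM] := boolP (j \in index_iota r M).
    rewrite (bigD1_seq j)//= ?iota_uniq// eqxx big1 ?addr0// => m.
    by rewrite eq_sym => /negbTE ->.
  rewrite big_seq big1// => m mM; case: eqP => // jm.
  by rewrite jm mM in jM.
Qed.

End comparison.

(** * The two rate functions and their generators *)

Section rates.
Context {R : realType}.
Variables (r : nat) (alpha beta : nat -> R) (xi : R).

Let qh := bd_rate r alpha beta.
Let qc := bd_catastrophe_rate r alpha beta xi.

Lemma bd_catastrophe_rateE j i : (r <= j)%N ->
  qc j i = qh j i + (if (r < j)%N && (i == r) then xi else 0).
Proof.
rewrite /qc /qh /bd_catastrophe_rate /bd_rate => rj.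
by do ![case: ifPn => ?]; rewrite ?addr0 ?add0r//; lia.
Qed.

Lemma sum_catastrophe_rate j (x : nat -> R) : (r <= j)%N ->
  \sum_(i < j.+2) qc j i * x i =
  \sum_(i < j.+2) qh j i * x i + (if (r < j)%N then xi * x r else 0).
Proof.
move=> rj; under eq_bigr do rewrite bd_catastrophe_rateE// mulrDl.
rewrite big_split/=; congr (_ + _).
have rj2 : (r < j.+2)%N by lia.
rewrite (bigD1 (Ordinal rj2))//= eqxx andbT big1 ?addr0 => [|i].
  by case: ifP; rewrite ?mul0r.
rewrite -val_eqE/= => /negbTE ->.
by rewrite andbF mul0r.
Qed.

Lemma out_catastrophe_rate j : (r <= j)%N ->
  out_rate qc j = out_rate qh j + (if (r < j)%N then xi else 0).
Proof.
move=> rj; have := sum_catastrophe_rate (fun=> 1) rj.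
rewrite !mulr1; under eq_bigr do rewrite mulr1.
by under [in X in _ = X -> _]eq_bigr do rewrite mulr1.
Qed.

(** The added term vanishes at [j = r], so counting a catastrophe in [r] as a jump to itself yields
    one formula for all states. *)
Lemma catastrophe_generatorE j (x : nat -> R) : (r <= j)%N ->
  - out_rate qc j * x j + \sum_(i < j.+2) qc j i * x i =
  - out_rate qh j * x j + \sum_(i < j.+2) qh j i * x i + xi * (x r - x j).
Proof.
move=> rj; rewrite out_catastrophe_rate// sum_catastrophe_rate//.
have [rj'|jr] := ltnP r j; first by ring.
by rewrite (_ : j = r); [ring|lia].
Qed.

Hypotheses (alpha_gt0 : forall n, (r <= n)%N -> 0 < alpha n)
  (beta_ge0 : forall n, (r.+1 <= n)%N -> 0 <= beta n).

Lemma bd_skip_free : skip_free r qh.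
Proof.
have qh0 i n : (r <= i)%N -> 0 <= qh i n.
  move=> ri; rewrite /qh /bd_rate; case: eqP => _; first exact/ltW/alpha_gt0.
  by case: ifP => // /andP[ir _]; exact: beta_ge0.
split => //.
- move=> i n ri ni; rewrite /qh /bd_rate ifF; last by lia.
  by rewrite ifF//; lia.
- by move=> i ri; rewrite /qh /bd_rate ifF ?ifF//; lia.
- by move=> i n ri nr; rewrite /qh /bd_rate ifF ?ifF//; lia.
- move=> i ri; rewrite /out_rate big_ord_recr/= ltr_wpDl//.
    by apply: sumr_ge0 => n _; exact: qh0.
  by rewrite /qh /bd_rate eqxx alpha_gt0.
Qed.

Lemma catastrophe_skip_free : 0 < xi -> skip_free r qc.
Proof.
move=> xi_gt0.
have [q0 qup qd qlow Q0] := bd_skip_free.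
split.
- move=> i n ri; rewrite bd_catastrophe_rateE// addr_ge0// ?q0//.
  by case: ifP => // _; exact: ltW.
- move=> i n ri ni; rewrite bd_catastrophe_rateE// qup// ifF ?addr0//; lia.
- move=> i ri; rewrite bd_catastrophe_rateE// qd// ifF ?addr0//; lia.
- move=> i n ri nr; rewrite bd_catastrophe_rateE// qlow// ifF ?addr0//; lia.
- move=> i ri; rewrite out_catastrophe_rate// ltr_wpDr ?Q0//.
  by case: ifP => // _; exact: ltW.
Qed.

End rates.

(** * Reduction to the catastrophe-free process *)

Section catastrophe.
Context {R : realType}.
Variables (r : nat) (alpha beta : nat -> R) (xi : R)
  (d d' : measure_display)
  (Omega : measurableType d) (Omega' : measurableType d')
  (P : nat -> probability Omega R) (P' : nat -> probability Omega' R)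
  (N : R -> Omega -> option nat) (Nhat : R -> Omega' -> option nat).
Hypotheses (alpha_gt0 : forall n, (r <= n)%N -> 0 < alpha n)
  (beta_ge0 : forall n, (r.+1 <= n)%N -> 0 <= beta n)
  (xi_gt0 : 0 < xi)
  (N_ctmc : is_ctmc [set n | (r <= n)%N]
     (bd_catastrophe_rate r alpha beta xi) P N)
  (Nhat_ctmc : is_ctmc [set n | (r <= n)%N] (bd_rate r alpha beta) P' Nhat)
  (Nhat_nonexplosive : forall j t, (r <= j)%N -> 0 <= t ->
     \sum_(r <= n < m) trans_prob P' Nhat j n t @[m --> \oo] --> (1 : R)).

Let qh := bd_rate r alpha beta.
Let qc := bd_catastrophe_rate r alpha beta xi.
Let qhP : skip_free r qh := bd_skip_free alpha_gt0 beta_ge0.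
Let qcP : skip_free r qc := catastrophe_skip_free alpha_gt0 beta_ge0 xi_gt0.
Let p := trans_prob P N.
Let ph := trans_prob P' Nhat.

(* Non-explosion makes the right-hand side of [bwd_comparison] vanish. *)
Lemma backward_unique n (T C : R) (V : nat -> R -> R) :
  (forall j t, (r <= j)%N -> 0 <= t <= T -> `|V j t| <= C) ->
  (forall j, (r <= j)%N -> V j 0 = (j == n)%:R) ->
  (forall j (t : R), (r <= j)%N -> 0 <= t <= T -> is_derive t 1 (V j)
     (- out_rate qh j * V j t + \sum_(i < j.+2) qh j i * V i t)) ->
  forall j t, (r <= j)%N -> 0 <= t <= T -> V j t = ph j n t.
Proof.
move=> VC V0 dV j t rj tT; have /andP[t0 _] := tT.
have bwdh m := cvg_bwd_trans_prob qhP Nhat_ctmc (n := m) rj t0.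
apply/eqP; rewrite -subr_eq0 -normr_eq0 eq_le normr_ge0 andbT.
(* For fixed [M] the comparison passes to the limit in [K]; only afterwards does [M] grow. *)
have VM M : `|V j t - ph j n t| <= C * (1 - \sum_(r <= m < M) ph j m t).
  rewrite -subr_ge0.
  apply: (@cvgr_ge_cst R (fun K => C * (1 - \sum_(r <= m < M) bwd qh K j m t) -
    `|V j t - bwd qh K j n t|)); last first.
    by move=> K; rewrite subr_ge0; exact: (bwd_comparison qhP _ VC V0 dV).
  apply: cvgB.
    apply: cvgM; first exact: cvg_cst.
    apply: cvgB; first exact: cvg_cst.
    by apply: cvgr_sum => m; exact: bwdh.
  by apply: cvg_norm; apply: cvgB; [exact: cvg_cst|exact: bwdh].
have lim0 : C * (1 - \sum_(r <= m < M) ph j m t) @[M --> \oo] --> C * (1 - 1).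
  apply: cvgM; first exact: cvg_cst.
  by apply: cvgB; [exact: cvg_cst|exact: Nhat_nonexplosive].
have := cvgr_ge_cst lim0 VM.
by rewrite subrr mulr0.
Qed.

(** [v] is a continuous version of [ph r n], and [Phi t] is the integral of [expR (- xi * s) * v s]
    over [[0, t]], specified by its derivative and its value at 0. *)
Lemma catastrophe_decomposition n : exists (Phi v : R -> R),
  [/\ forall t : R, 0 <= t -> v t = ph r n t,
      forall t : R, 0 <= t -> {for t, continuous v},
      forall t : R, 0 <= t -> is_derive t 1 Phi (expR (- xi * t) * v t),
      Phi 0 = 0 &
      forall j t, (r <= j)%N -> 0 <= t ->
        p j n t = expR (- xi * t) * ph j n t + xi * Phi t].
Proof.
have [p' [p'p p'0 p'01 dp']] := backward_equation qcP (fun j t rj t0 =>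
  cvg_bwd_trans_prob qcP N_ctmc (n := n) rj t0).
pose H := prim (fun s => expR (xi * s) * p' r s).
pose V j t := expR (xi * t) * p' j t - xi * H t.
have dE (t : R) : is_derive t 1 (fun s => expR (xi * s)) (xi * expR (xi * t)).
  exact: is_derive_expRM.
have cE (t : R) : 0 <= t -> {for t, continuous (fun s : R => expR (xi * s) * p' r s)}.
  move=> t0; apply: cvgM; first exact: (is_derive_continuous (dE t)).
  exact: (is_derive_continuous (dp' r t (leqnn r) t0)).
have dH (t : R) : 0 <= t -> is_derive t 1 H (expR (xi * t) * p' r t).
  by move=> t0; exact: is_derive_prim.
have H0 : H 0 = 0 by exact: prim0.
(* The term [xi * (p' r - p' j)] of the generator cancels against the derivatives of [expR (xi * t)]
   and [xi * H t]. Subtracting [xi * H t], constant in [j], does not change the catastrophe-free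
   generator. *)
have dV j (t : R) : (r <= j)%N -> 0 <= t -> is_derive t 1 (V j)
    (- out_rate qh j * V j t + \sum_(i < j.+2) qh j i * V i t).
  move=> rj t0.
  apply: is_derive_eqP (is_derive_subf (is_derive_mulf (dE t) (dp' j t rj t0))
    (is_derive_scalef xi (dH t t0))).
  rewrite (catastrophe_generatorE alpha beta xi (p' ^~ t) rj).
  have -> : \sum_(i < j.+2) qh j i * V i t =
      expR (xi * t) * (\sum_(i < j.+2) qh j i * p' i t) - out_rate qh j * (xi * H t).
    rewrite /out_rate mulr_sumr mulr_suml -sumrB; apply: eq_bigr => i _.
    by rewrite /V; ring.
  rewrite /V -/qh; move: (out_rate qh j) (\sum_(i < _) _) (H t) => x y z.
  by ring.
have VE j (t : R) : (r <= j)%N -> 0 <= t -> V j t = ph j n t.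
  move=> rj t0.
  (* As [p' <= 1], on [[0, t]] the first term of [V] is at most [expR (xi * t)], and [H], with
     derivative at most [expR (xi * t)], is at most [expR (xi * t) * t]. *)
  have := @backward_unique n t (expR (xi * t) + xi * (expR (xi * t) * t)) V.
  apply => //; last 2 first.
  - by move=> i s ri /andP[s0 _]; exact: dV.
  - by rewrite t0 lexx.
  - move=> i s ri /andP[s0 st]; rewrite /V.
    have /andP[b0 b1] := p'01 i s ri s0.
    have Hs : `|H s| <= expR (xi * t) * t.
      have -> : H s = H s - H 0 by rewrite H0 subr0.
      apply: (le_trans (is_derive_lipschitz (L := expR (xi * t)) s0 _ _)).
      + by move=> u /andP[u0 _]; exact: dH.
      + move=> u /andP[u0 us]; have /andP[c0 c1] := p'01 r u (leqnn r) u0.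
        rewrite normrM (ger0_norm (expR_ge0 _)) (ger0_norm c0) -[leRHS]mulr1.
        by rewrite ler_pM ?expR_ge0// ler_expR ler_pM2l// (le_trans us).
      + by rewrite subr0 ler_wpM2l ?expR_ge0.
    apply: (le_trans (ler_normB _ _)); apply: lerD; last first.
      by rewrite normrM gtr0_norm// ler_pM2l.
    rewrite normrM (ger0_norm (expR_ge0 _)) (ger0_norm b0) -[leRHS]mulr1.
    by rewrite ler_pM ?expR_ge0// ler_expR ler_pM2l.
  - by move=> i ri; rewrite /V H0 !mulr0 expR0 mul1r subr0 p'0.
have EE (t : R) : expR (- xi * t) * expR (xi * t) = 1.
  by rewrite -expRD mulNr addNr expR0.
(* Solving the linear equation for [H]: the product rule gives this witness the derivative
   [expR (- xi * t) * V r t]. *)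
exists (fun t => expR (- xi * t) * H t), (V r); split.
- by move=> t t0; exact: VE.
- by move=> t t0; exact: is_derive_continuous (dV r t (leqnn r) t0).
- move=> t t0; apply: is_derive_eqP (is_derive_mulf (is_derive_expRM (- xi) t) (dH t t0)).
  by rewrite /V; ring.
- by rewrite H0 mulr0.
- move=> j t rj t0; rewrite /p -(p'p j t rj t0) -(VE j t rj t0) /V.
  move: (H t) (p' j t) (expR _) (expR _) (EE t) => x y e' e ee'.
  transitivity (e * e' * y); last by ring.
  by rewrite ee' mul1r.
Qed.

End catastrophe.

(** * Laplace transforms at [xi] *)

Section laplace_transform.
Context {R : realType}.
Notation mu := (@lebesgue_measure R).
Variables (xi : R) (xi_gt0 : 0 < xi).

Lemma cvg_expRNM : expR (- xi * t) @[t --> +oo] --> (0 : R).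
Proof.
under eq_fun do rewrite mulNr.
apply: (@cvg_comp _ _ _ (fun t => xi * t) (fun y => expR (- y)) _ (+oo%R)).
  by apply: gt0_cvgMry => //; exact: cvg_id.
exact: cvgr_expR.
Qed.

(** The factor [1] gives the shape needed in [integral_expRNM] at [v = 1]; the same primitive is the
    upper barrier for [Phi] there. *)
Lemma is_derive_expRN_primitive (t : R) :
  is_derive t 1 (fun s => xi^-1 - xi^-1 * expR (- xi * s)) (expR (- xi * t) * 1).
Proof.
apply: is_derive_eqP (is_derive_subf (is_derive_cstf xi^-1 t)
  (is_derive_scalef xi^-1 (is_derive_expRM (- xi) t))).
by rewrite sub0r mulNr mulrN opprK mulrA mulVf ?gt_eqF// mul1r mulr1.
Qed.

(** [Phi] is nondecreasing and at most [xi^-1], so it has a limit, which the fundamental theorem of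
    calculus on the half-line identifies with the integral. *)
Lemma integral_expRNM (v Phi : R -> R) :
  (forall t : R, 0 <= t -> 0 <= v t <= 1) ->
  (forall t : R, 0 <= t -> {for t, continuous v}) ->
  (forall t : R, 0 <= t -> is_derive t 1 Phi (expR (- xi * t) * v t)) ->
  Phi 0 = 0 ->
  exists2 l, Phi t @[t --> +oo] --> l &
    (\int[mu]_(t in `[0%R, +oo[) (expR (- (xi * t)) * v t)%:E = l%:E)%E.
Proof.
move=> v01 cv dPhi Phi0.
(* Being constant to the left of 0, [G] is monotone on the whole line. *)
pose G t := Phi (Num.max 0 t).
have nd : {homo G : x y / x <= y}.
  move=> x y xy; rewrite /G.
  apply: (@is_derive_ndecr _ Phi (fun t => expR (- xi * t) * v t)).
  - by rewrite ge_max le_max lexx/= le_max xy orbT.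
  - by move=> t /andP[+ _]; rewrite ge_max => /andP[t0 _]; exact: dPhi.
  - move=> t /andP[+ _]; rewrite ge_max => /andP[t0 _].
    by rewrite mulr_ge0 ?expR_ge0//; have /andP[] := v01 t t0.
have ub : has_ubound (range G).
  exists xi^-1 => _ [x _ <-]; rewrite /G; set t := Num.max 0 x.
  have t0 : 0 <= t by rewrite le_max lexx.
  (* Since [v <= 1], the primitive of [expR (- xi * s)] vanishing at 0 grows at least as fast as
     [Phi]. *)
  have := @is_derive_ndecr _ (fun s => xi^-1 - xi^-1 * expR (- xi * s) - Phi s)
    (fun s => expR (- xi * s) * 1 - expR (- xi * s) * v s) 0 t t0.
  rewrite Phi0 mulr0 expR0 mulr1 subrr subr0 => D.
  suff : 0 <= xi^-1 - xi^-1 * expR (- xi * t) - Phi t.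
    rewrite subr_ge0 => /le_trans; apply.
    by rewrite gerBl mulr_ge0 ?expR_ge0// invr_ge0 ltW.
  apply: D => s /andP[s0 _].
    exact: is_derive_subf (is_derive_expRN_primitive s) (dPhi s s0).
  rewrite subr_ge0 ler_wpM2l ?expR_ge0//.
  by have /andP[] := v01 s s0.
have cvG := nondecreasing_cvgr nd ub.
set l := sup (range G) in cvG.
have cvP : Phi t @[t --> +oo] --> l.
  apply: cvg_trans cvG; apply: near_eq_cvg.
  near=> t; rewrite /G; congr Phi; apply/max_idPr.
  by near: t; exact: nbhs_pinfty_ge.
exists l => //.
pose f t := expR (- (xi * t)) * v t.
have cf (t : R) : 0 <= t -> {for t, continuous f}.
  move=> t0; apply: cvgM; last exact: cv.
  rewrite -mulNr; under eq_fun do rewrite -mulNr.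
  exact: (is_derive_continuous (is_derive_expRM _ _)).
rewrite (@ge0_continuous_FTC2y R f Phi 0 l).
- by rewrite Phi0 sube0.
- by move=> t t0; rewrite mulr_ge0 ?expR_ge0//; have /andP[] := v01 t t0.
- apply: continuous_in_subspaceT => t; rewrite inE/= in_itv/= andbT => t0.
  exact: cf.
- exact: cvP.
- by move=> t t0; have [] := dPhi t (ltW t0).
- apply: cvg_at_right_filter; exact: (is_derive_continuous (dPhi 0 (lexx 0))).
- move=> t; rewrite in_itv/= andbT => /ltW t0.
  by rewrite derive1E; have [_ ->] := dPhi t t0; rewrite /f mulNr.
Unshelve. all: by end_near. Qed.

Lemma cvg_laplace (v Phi : R -> R) :
  (forall t : R, 0 <= t -> 0 <= v t <= 1) ->
  (forall t : R, 0 <= t -> {for t, continuous v}) ->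
  (forall t : R, 0 <= t -> is_derive t 1 Phi (expR (- xi * t) * v t)) ->
  Phi 0 = 0 -> Phi t @[t --> +oo] --> laplace v xi.
Proof.
move=> v01 cv dPhi Phi0; have [l Phil lE] := integral_expRNM v01 cv dPhi Phi0.
by rewrite /laplace /Rintegral lE.
Qed.

Let I := `[0%R, +oo[%classic : set R.

Let I_ge0 t : I t -> 0 <= t.
Proof. by rewrite /I/= in_itv/= andbT. Qed.

Lemma integral_expRN1 : (\int[mu]_(t in I) (expR (- (xi * t)))%:E = xi^-1%:E)%E.
Proof.
have [||| l cvl lE] := integral_expRNM (v := fun=> 1) _ _
  (fun t _ => is_derive_expRN_primitive t).
- by move=> t _; rewrite ler01 lexx.
- by move=> t _; exact: cst_continuous.
- by rewrite mulr0 expR0 mulr1 subrr.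
rewrite -[in RHS](_ : l = xi^-1).
  by rewrite -lE; apply: eq_integral => t _; rewrite mulr1.
have cv : xi^-1 - xi^-1 * expR (- xi * t) @[t --> +oo] --> xi^-1 - xi^-1 * 0.
  apply: cvgB; first exact: cvg_cst.
  by apply: cvgM; [exact: cvg_cst|exact: cvg_expRNM].
by rewrite mulr0 subr0 in cv; exact: (cvg_unique _ cvl cv).
Qed.

Lemma integrable_expRN : mu.-integrable I (fun t => (expR (- (xi * t)))%:E).
Proof.
apply/integrableP; split.
  apply/measurable_EFinP; apply: measurable_funTS.
  apply: continuous_measurable_fun => t.
  under eq_fun do rewrite -mulNr.
  exact: (is_derive_continuous (is_derive_expRM (- xi) t)).
under eq_integral do rewrite /= ger0_norm ?expR_ge0//.
by rewrite integral_expRN1 ltry.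
Qed.

Lemma integrable_laplace (w : R -> R) : measurable_fun I w ->
  (forall t, 0 <= t -> `|w t| <= 1) ->
  mu.-integrable I (fun t => (expR (- (xi * t)) * w t)%:E).
Proof.
move=> mw w1.
have mf : measurable_fun I (EFin \o (fun t => expR (- (xi * t)) * w t)).
  apply/measurable_EFinP; apply: measurable_funM => //.
  by apply/measurable_EFinP; exact: measurable_int integrable_expRN.
apply: (@le_integrable _ _ R mu I _ _ _ mf _ integrable_expRN) => //.
  exact: measurable_itv.
move=> t /I_ge0/w1 wt1.
by rewrite lee_fin normrM ler_piMr.
Qed.

Lemma laplaceD (w1 w2 : R -> R) :
  mu.-integrable I (fun t => (expR (- (xi * t)) * w1 t)%:E) ->
  mu.-integrable I (fun t => (expR (- (xi * t)) * w2 t)%:E) ->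
  laplace (fun t => w1 t + w2 t) xi = laplace w1 xi + laplace w2 xi.
Proof.
move=> i1 i2; rewrite /laplace -RintegralD//.
by apply: eq_Rintegral => t _; rewrite mulrDr.
Qed.

Lemma laplace_sum (s : seq nat) (w : nat -> R -> R) :
  (forall n, mu.-integrable I (fun t => (expR (- (xi * t)) * w n t)%:E)) ->
  laplace (fun t => \sum_(n <- s) w n t) xi = \sum_(n <- s) laplace (w n) xi.
Proof.
move=> iw; elim: s => [|n s IH].
  rewrite big_nil /laplace (_ : (fun _ => _) = fun=> 0).
    by rewrite Rintegral_cst// mul0r.
  by apply/funext => t; rewrite big_nil mulr0.
rewrite big_cons -IH -laplaceD//.
  by congr (laplace _ xi); apply/funext => t; rewrite big_cons.
have -> : (fun t => (expR (- (xi * t)) * \sum_(m <- s) w m t)%:E) =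
    (fun t => \sum_(m <- s) (expR (- (xi * t)) * w m t)%:E)%E.
  by apply/funext => t; rewrite mulr_sumr sumEFin.
by apply: integrable_sum => //; exact: measurable_itv.
Qed.

(** Dominated convergence under [expR (- (xi * t))], whose integral is [xi^-1]. *)
Lemma cvg_laplace_dominated (w : nat -> R -> R) :
  (forall n, measurable_fun I (w n)) ->
  (forall n t, 0 <= t -> `|w n t| <= 1) ->
  (forall t, 0 <= t -> w n t @[n --> \oo] --> (1 : R)) ->
  laplace (w n) xi @[n --> \oo] --> xi^-1.
Proof.
move=> mw w1 wl; apply: fine_cvg; rewrite -integral_expRN1.
apply: (@dominated_cvg _ _ R mu I (measurable_itv _)
  (fun n t => (expR (- (xi * t)) * w n t)%:E) (fun t => (expR (- (xi * t)))%:E)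
  (fun t => (expR (- (xi * t)))%:E)).
- by move=> n; exact: measurable_int (integrable_laplace (mw n) (w1 n)).
- move=> t /I_ge0 t0; apply: cvg_EFin; first exact: nearW.
  rewrite -[X in _ --> X]mulr1; apply: cvgM; [exact: cvg_cst|exact: wl].
- by [].
- exact: integrable_expRN.
- move=> n t /I_ge0 t0.
  by rewrite lee_fin normrM ger0_norm ?expR_ge0// ler_piMr ?expR_ge0// w1.
Qed.

End laplace_transform.

(** * Convergence to the steady state and its total mass *)

Theorem mainTheorem9 (R : realType) (r : nat) (alpha beta : nat -> R) (xi : R)
    (d d' : measure_display)
    (Omega : measurableType d) (Omega' : measurableType d')
    (P : nat -> probability Omega R) (P' : nat -> probability Omega' R)
    (N : R -> Omega -> option nat) (Nhat : R -> Omega' -> option nat)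
    (alpha_gt0 : forall n, (r <= n)%N -> 0 < alpha n)
    (beta_ge0 : forall n, (r.+1 <= n)%N -> 0 <= beta n)
    (xi_gt0 : 0 < xi)
    (N_ctmc : is_ctmc [set n | (r <= n)%N]
       (bd_catastrophe_rate r alpha beta xi) P N)
    (Nhat_ctmc : is_ctmc [set n | (r <= n)%N] (bd_rate r alpha beta) P' Nhat)
    (Nhat_nonexplosive : forall j t, (r <= j)%N -> 0 <= t ->
       \sum_(r <= n < m) trans_prob P' Nhat j n t @[m --> \oo] --> (1 : R)) :
  exists q : nat -> R,
  [/\ forall j n, (r <= j)%N -> (r <= n)%N ->
        trans_prob P N j n t @[t --> +oo] --> q n,
      forall n, (r <= n)%N -> q n = xi * laplace (trans_prob P' Nhat r n) xi &
      \sum_(r <= n < m) q n @[m --> \oo] --> (1 : R)].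
Proof.
have qhP := bd_skip_free alpha_gt0 beta_ge0.
have deco := catastrophe_decomposition alpha_gt0 beta_ge0 xi_gt0 N_ctmc
  Nhat_ctmc Nhat_nonexplosive.
set p := trans_prob P N; set ph := trans_prob P' Nhat.
have ph01 j n t : (r <= j)%N -> 0 <= t -> 0 <= ph j n t <= 1.
  by move=> rj t0; exact: (trans_prob_itv qhP Nhat_ctmc).
(* Measurability comes from the continuous version [v], equal to [ph r n] on the half-line. *)
have mph n : measurable_fun (`[0%R, +oo[%classic : set R) (ph r n).
  have [Phi [v [vE cv _ _ _]]] := deco n.
  apply: (@eq_measurable_fun _ _ _ _ _ v).
    by move=> t; rewrite inE/= in_itv/= andbT; exact: vE.
  apply: subspace_continuous_measurable_fun; first exact: measurable_itv.
  apply: continuous_in_subspaceT => t; rewrite inE/= in_itv/= andbT; exact: cv.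
exists (fun n => xi * laplace (ph r n) xi); split => //.
- move=> j n rj rn; have [Phi [v [vE cv dPhi Phi0 pE]]] := deco n.
  have cvPhi : Phi t @[t --> +oo] --> laplace (ph r n) xi.
    have -> : laplace (ph r n) xi = laplace v xi.
      by apply: eq_Rintegral => t; rewrite inE/= in_itv/= andbT => t0; rewrite vE.
    apply: cvg_laplace => // t t0; rewrite vE//; exact: ph01.
  (* The only term that depends on the initial state [j] dies out. *)
  have cvE : expR (- xi * t) * ph j n t @[t --> +oo] --> (0 : R).
    apply: (squeeze_cvgr _ (cvg_cst 0) (cvg_expRNM xi_gt0)).
    near=> t; have t0 : 0 <= t by near: t; exact: nbhs_pinfty_ge.
    have /andP[b0 b1] := ph01 j n t rj t0.
    by rewrite mulr_ge0 ?expR_ge0//= ler_piMr ?expR_ge0.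
  rewrite -[X in _ --> X]add0r.
  have cvS : expR (- xi * t) * ph j n t + xi * Phi t @[t --> +oo] -->
      0 + xi * laplace (ph r n) xi.
    by apply: cvgD => //; apply: cvgM => //; exact: cvg_cst.
  apply: cvg_trans cvS; apply: near_eq_cvg; near=> t.
  by rewrite [RHS]pE//; near: t; exact: nbhs_pinfty_ge.
- have int n : lebesgue_measure.-integrable (`[0%R, +oo[%classic : set R)
      (fun t => (expR (- (xi * t)) * ph r n t)%:E).
    apply: (integrable_laplace xi_gt0) => // t t0.
    by have /andP[b0 b1] := ph01 r n t (leqnn r) t0; rewrite ger0_norm.
  (* Moving the finite sum inside the transform reduces the total mass to the limit [xi^-1] of the
     transforms of partial sums. *)
  have sumE m : \sum_(r <= n < m) xi * laplace (ph r n) xi =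
      xi * laplace (fun t => \sum_(r <= n < m) ph r n t) xi.
    by rewrite laplace_sum// mulr_sumr.
  rewrite (funext sumE) -[X in _ --> X](divff (lt0r_neq0 xi_gt0)).
  apply: cvgM; first exact: cvg_cst.
  apply: (cvg_laplace_dominated xi_gt0).
  + by move=> m; apply: measurable_sum.
  (* The partial sums are nondecreasing in [m], hence bounded by their limit 1. *)
  + move=> m t t0; rewrite ger0_norm; last first.
      by apply: sumr_ge0 => n _; have /andP[] := ph01 r n t (leqnn r) t0.
    have cv := Nhat_nonexplosive r t (leqnn r) t0.
    rewrite -(cvg_lim _ cv)//.
    apply: (@nondecreasing_cvgn_le _ (fun m => \sum_(r <= n < m) ph r n t)).
      apply/nondecreasing_seqP => k; have [rk|kr] := leqP r k.
        rewrite big_nat_recr//= lerDl.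
        by have /andP[] := ph01 r k t (leqnn r) t0.
      by rewrite !big_geq// ltnW.
    exact: cvgP cv.
  + by move=> t t0; exact: Nhat_nonexplosive.
Unshelve. all: by end_near. Qed.
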